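(* Let $k$ be a field of characteristic $0$, let $S=k[x_1,\dots,x_n]$ be a polynomial ring over $k$ and let $I$ be a homogeneous ideal of $S$. Then $$\mathrm{bdeg}(S/I)=\mathrm{bdeg}(S/\mathrm{gin}(I)),$$ where $\mathrm{gin}(I)$ is the generic initial ideal of $I$ with respect to the reverse lexicographic order.
   Context: $S$ is standard graded with irrelevant ideal $\mathfrak m=(x_1,\dots,x_n)$. Generic initial ideal: for monomials (with exponents $\deg_{x_i}$), $m_1\succ_{rlex} m_2$ if $\deg(m_1)>\deg(m_2)$, or $\deg(m_1)=\deg(m_2)$ and there is $j$ with $\deg_{x_i}(m_1)=\deg_{x_i}(m_2)$ for $i>j$ and $\deg_{x_j}(m_1)<\deg_{x_j}(m_2)$. The initial ideal $\mathrm{in}(I)$ is generated by the leading terms of the elements of $I$ for this order. $GL(S_{\langle1\rangle})$ acts on $S$ by linear changes of variables, and $\mathrm{gin}(I)$ is the unique monomial ideal equal to $\mathrm{in}(\sigma\cdot I)$ for all $\sigma$ in some nonempty Zariski-open subset of $GL(S_{\langle1\rangle})$. For a homogeneous $k$-algebra $R=\bigoplus_{i\ge0}R_{\langle i\rangle}$ (a quotient of a standard graded polynomial ring over $k$ by a homogeneous ideal), let $\mathcal M(R)$ be the category of finitely generated graded $R$-modules. $\ell$ is length, $\Gamma_{\mathfrak m}(M)=\{z\in M: \mathfrak m^t z=0 \text{ for } t\gg0\}$, and $\deg(M)$ is the multiplicity of $M$ ($=\ell(M)$ if $\dim M=0$). A notion of genericity on $\mathcal M(R)$ is a function $U$ assigning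 to each isomorphism class of modules $M$ a non-empty subset $U(M)\subseteq R_{\langle1\rangle}$ that contains a nonempty Zariski-open subset of $R_{\langle1\rangle}$ and such that, if $\mathrm{depth}(M)>0$, every $f\in U(M)$ is regular on $M$. The extremal cohomological degree $\mathrm{bdeg}(-)$ is the unique function from isomorphism classes of $\mathcal M(R)$ to $\mathbf N$ for which there is a notion of genericity $U$ such that for all $M$: (1) $\mathrm{bdeg}(M)=\deg(M)$ if $M$ is Cohen-Macaulay; (2) if $L=\Gamma_{\mathfrak m}(M)$, then $\mathrm{bdeg}(M)=\mathrm{bdeg}(M/L)+\ell(L)$; (3) if $\mathrm{depth}(M)>0$ and $x\in U(M)$, then $\mathrm{bdeg}(M)=\mathrm{bdeg}(M/xM)$. (Such a function exists and is unique.) Here one may take the base ring to be $S$. *)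

(* Defs.v *)
From HB Require Import structures.
From mathcomp Require Import all_boot all_order all_algebra.
From mathcomp Require Import generic_quotient ring_quotient boolp mpoly.

Set Implicit Arguments.
Unset Strict Implicit.
Unset Printing Implicit Defensive.

Import GRing.Theory.
Local Open Scope ring_scope.

Definition is_max (P : nat -> Prop) (d : nat) : Prop :=
  P d /\ forall e, P e -> (e <= d)%N.

Definition strict_incl (T : Type) (A B : T -> Prop) : Prop :=
  (forall x, A x -> B x) /\ exists x, B x /\ ~ A x.

Section Ideals.
Variables (k : fieldType) (n : nat).
Local Notation S := {mpoly k[n]}.

Definition submodule (M : lmodType S) (N : M -> Prop) : Prop :=
  N 0 /\ forall (p : S) x y, N x -> N y -> N (p *: x + y).

Definition ideal (I : S -> Prop) : Prop := @submodule S^o I.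

Definition prime_ideal (P : S -> Prop) : Prop :=
  [/\ ideal P, ~ P 1 & forall p q, P (p * q) -> P p \/ P q].

Definition ideal_gen (A : S -> Prop) (f : S) : Prop :=
  forall I, ideal I -> (forall g, A g -> I g) -> I f.

Definition ideal_pow (I : S -> Prop) (t : nat) : S -> Prop :=
  ideal_gen (fun f => exists s : seq S,
    [/\ size s = t, forall g, g \in s -> I g & f = \prod_(g <- s) g]).

Definition irrelevant : S -> Prop := ideal_gen (fun f => exists i, f = 'X_i).

End Ideals.

Section GradedModules.
Variables (k : fieldType) (n : nat).
Local Notation S := {mpoly k[n]}.

Record is_grading (M : lmodType S) (gr : int -> M -> Prop) : Prop := IsGrading {
  gr0 : forall d, gr d 0;
  grB : forall d x y, gr d x -> gr d y -> gr d (x - y);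
  grZ : forall (i : nat) d (p : S) x,
    p \is i.-homog -> gr d x -> gr (i%:Z + d) (p *: x);
  gr_span : forall x, exists (s : seq int) (f : int -> M),
    [/\ uniq s, forall d, gr d (f d) & x = \sum_(d <- s) f d];
  gr_indep : forall (s : seq int) (f : int -> M),
    uniq s -> (forall d, gr d (f d)) -> \sum_(d <- s) f d = 0 ->
    forall d, d \in s -> f d = 0 }.

Definition fin_gen (M : lmodType S) : Prop :=
  exists g : seq M, forall x, exists c : 'I_(size g) -> S,
    x = \sum_(i < size g) c i *: g`_i.

(** Finitely generated [Z]-graded [S]-modules. *)
Record gmod := GMod {
  gm_sort :> lmodType S;
  gr : int -> gm_sort -> Prop;
  gm_grading : is_grading gr;
  gm_fg : fin_gen gm_sort }.

Definition gmod_iso (M N : gmod) : Prop :=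
  exists f : {linear M -> N}, bijective f /\ forall d x, gr d x -> gr d (f x).

(** Homogeneous submodules: [gs_homog] says that the homogeneous components of
    an element of the submodule lie in the submodule. *)
Record gsub (M : gmod) := GSub {
  gs_mem :> M -> Prop;
  gs_submod : submodule gs_mem;
  gs_homog : forall (s : seq int) (f : int -> M),
    uniq s -> (forall d, gr d (f d)) -> gs_mem (\sum_(d <- s) f d) ->
    forall d, d \in s -> gs_mem (f d) }.

Section GradingTheory.
Variable M : gmod.

Lemma gr_shift (i : nat) (q : S) (f : int -> M) : q \is i.-homog ->
  (forall d, gr d (f d)) -> forall d, gr d (q *: f (d - i%:Z)).
Proof.
move=> hq hf d; have := grZ (gm_grading M) hq (hf (d - i%:Z)).
by rewrite addrC subrK.
Qed.

Lemma gr_sub_eq (s1 s2 : seq int) (f g : int -> M) :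
  uniq s1 -> uniq s2 -> (forall d, gr d (f d)) -> (forall d, gr d (g d)) ->
  \sum_(d <- s1) f d = \sum_(d <- s2) g d ->
  forall d, d \in s1 -> f d = if d \in s2 then g d else 0.
Proof.
move=> u1 u2 hf hg e d hd.
have gr0 := gr0 (gm_grading M).
pose h d := (if d \in s1 then f d else 0) - (if d \in s2 then g d else 0).
have us : uniq (undup (s1 ++ s2)) by exact: undup_uniq.
have ext (s : seq int) (F : int -> M) : uniq s -> {subset s <= undup (s1 ++ s2)} ->
    \sum_(d <- undup (s1 ++ s2)) (if d \in s then F d else 0) = \sum_(d <- s) F d.
  move=> uq sb; rewrite -big_mkcond /= -big_filter.
  apply: perm_big; apply: uniq_perm => //; first by rewrite filter_uniq.
  by move=> z; rewrite mem_filter; apply/andP/idP => [[]//|zs]; split=> //; apply: sb.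
have h0 : \sum_(d <- undup (s1 ++ s2)) h d = 0.
  rewrite sumrB !ext ?e ?subrr // => z zs; by rewrite mem_undup mem_cat zs ?orbT.
have hgr z : gr z (h z).
  by apply: (grB (gm_grading M)); case: ifP.
have /(_ d) := gr_indep (gm_grading M) us hgr h0.
rewrite mem_undup mem_cat hd => /(_ isT) /eqP.
by rewrite /h hd subr_eq0 => /eqP.
Qed.

End GradingTheory.

Section Quotient.
Variables (M : gmod) (N : gsub M).

Definition gs_pred : pred M := fun x => `[< N x >].

Lemma gs_predP x : reflect (N x) (x \in gs_pred).
Proof. exact: asboolP. Qed.

Lemma gs_pred_zmod : zmod_closed gs_pred.
Proof.
have [N0 NZ] := gs_submod N.
split; first exact/gs_predP.
move=> x y /gs_predP hx /gs_predP hy; apply/gs_predP.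
by rewrite addrC -scaleN1r; apply: NZ.
Qed.

Definition gs_zmod : zmodClosed M :=
  HB.pack_for (zmodClosed M) gs_pred
    (GRing.isZmodClosed.Build M gs_pred gs_pred_zmod).

Definition quot_sort : Type := Quotient.quot gs_zmod.
HB.instance Definition _ := GRing.Zmodule.on quot_sort.

Definition quot_pi (x : M) : quot_sort := \pi_(Quotient.quot gs_zmod)%qT x.

Lemma quot_pi_surj q : exists x, q = quot_pi x.
Proof. by exists (repr (q : Quotient.quot gs_zmod)); rewrite /quot_pi reprK. Qed.

Lemma quot_piB x y : quot_pi (x - y) = quot_pi x - quot_pi y.
Proof. exact: (raddfB (\pi_(Quotient.quot gs_zmod)%qT)). Qed.

Lemma quot_piD x y : quot_pi (x + y) = quot_pi x + quot_pi y.
Proof. exact: (raddfD (\pi_(Quotient.quot gs_zmod)%qT)). Qed.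

Lemma quot_pi0 : quot_pi 0 = 0.
Proof. by rewrite -(subrr 0) quot_piB subrr. Qed.

Lemma quot_pi_eq x y : quot_pi x = quot_pi y <-> N (x - y).
Proof.
have E : (x - y \in gs_pred) = (quot_pi x == quot_pi y)
  by exact: (Quotient.idealrBE gs_zmod x y).
split=> [e|h]; first by apply/gs_predP; rewrite E; apply/eqP.
by apply/eqP; rewrite -E; apply/gs_predP.
Qed.

Definition quot_scale (p : S) (q : quot_sort) : quot_sort :=
  quot_pi (p *: repr (q : Quotient.quot gs_zmod)).

Lemma quot_piZ p x : quot_scale p (quot_pi x) = quot_pi (p *: x).
Proof.
apply/quot_pi_eq; rewrite -scalerBr.
have [N0 NZ] := gs_submod N.
rewrite -[_ *: _]addr0; apply: NZ => //; apply/quot_pi_eq.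
by rewrite /quot_pi reprK.
Qed.

Lemma quot_scaleA a b q : quot_scale a (quot_scale b q) = quot_scale (a * b) q.
Proof. by have [x ->] := quot_pi_surj q; rewrite !quot_piZ scalerA. Qed.
Lemma quot_scale1 : left_id 1 quot_scale.
Proof. by move=> q; have [x ->] := quot_pi_surj q; rewrite quot_piZ scale1r. Qed.
Lemma quot_scaleDr : right_distributive quot_scale +%R.
Proof.
move=> a q r; have [x ->] := quot_pi_surj q; have [y ->] := quot_pi_surj r.
by rewrite -quot_piD !quot_piZ scalerDr quot_piD.
Qed.
Lemma quot_scaleDl q : {morph quot_scale^~ q : a b / a + b}.
Proof.
by move=> a b; have [x ->] := quot_pi_surj q; rewrite !quot_piZ scalerDl quot_piD.
Qed.

HB.instance Definition _ := GRing.Zmodule_isLmodule.Build S quot_sort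
  quot_scaleA quot_scale1 quot_scaleDr quot_scaleDl.

Definition quot_gr (d : int) (q : quot_sort) : Prop :=
  exists2 x : M, gr d x & q = quot_pi x.

Lemma quot_pi_sum (I : Type) (s : seq I) (f : I -> M) :
  \sum_(d <- s) quot_pi (f d) = quot_pi (\sum_(d <- s) f d).
Proof.
by elim: s => [|d s IH]; rewrite ?big_nil ?quot_pi0 // !big_cons IH quot_piD.
Qed.

Lemma quot_grading : is_grading quot_gr.
Proof.
have H := gm_grading M; split.
- by move=> d; exists 0; rewrite ?quot_pi0 //; apply: (gr0 H).
- move=> d _ _ [x hx ->] [y hy ->]; exists (x - y); rewrite ?quot_piB //.
  exact: (grB H).
- move=> i d p _ hp [x hx ->]; exists (p *: x); last exact: quot_piZ.
  exact: (grZ H).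
- move=> q; have [x ->] := quot_pi_surj q.
  have [s [f [us hf ->]]] := gr_span H x.
  exists s, (fun d => quot_pi (f d)); split=> //; last by rewrite quot_pi_sum.
  by move=> d; exists (f d).
- move=> s f us hf e d ds.
  have /choice[g hg] : forall d, exists x, gr d x /\ f d = quot_pi x.
    by move=> d'; have [x ? ?] := hf d'; exists x.
  have [_ ->] := hg d; rewrite -quot_pi0; apply/quot_pi_eq; rewrite subr0.
  apply: (gs_homog us _ _ ds) => [d'|]; first by case: (hg d').
  rewrite -[X in N X]subr0; apply/quot_pi_eq; rewrite quot_pi0 -quot_pi_sum; apply: etrans e.
  by apply: eq_bigr => d' _; case: (hg d').
Qed.

Lemma quot_fg : fin_gen quot_sort.
Proof.
have [g hg] := gm_fg M; exists [seq quot_pi x | x <- g] => q.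
have [x ->] := quot_pi_surj q; have [c ->] := hg x.
have e : size [seq quot_pi x | x <- g] = size g by rewrite size_map.
exists (fun i => c (cast_ord e i)).
rewrite -quot_pi_sum (reindex (cast_ord e)) /=; last first.
  by exists (cast_ord (esym e)) => i _; rewrite ?cast_ordK ?cast_ordKV.
apply: eq_bigr => i _; rewrite -quot_piZ; congr quot_scale.
by rewrite (nth_map 0) // -e.
Qed.

Definition gquot : gmod := GMod quot_grading quot_fg.

End Quotient.

Section FreeModule.

Definition poly_gr (d : int) (p : S^o) : Prop :=
  match d with Posz i => (p : S) \is i.-homog | Negz _ => p = 0 end.

Lemma poly_grading : is_grading poly_gr.
Proof.
split.
- by move=> [i|i] //=; apply: rpred0.
- move=> [i|i] x y /=; first by move=> hx hy; apply: rpredB.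
  by move=> -> ->; rewrite subr0.
- move=> i [j|j] p x hp /=; first by move=> hx; apply: dhomogM.
  move=> ->; rewrite scaler0; case: (i%:Z + Negz j) => [l|l] //=.
  exact: rpred0.
- move=> p; pose m := msize (p : S).
  exists [seq Posz i | i <- iota 0 m],
    (fun d => match d with Posz i => pihomog mdeg i (p : S) | Negz _ => 0 end).
  split; first by rewrite map_inj_uniq ?iota_uniq // => a b [].
    by move=> [i|i] //=; apply: pihomogP.
  rewrite big_map /= {1}(@pihomog_partitionE _ _ mdeg m (p : S)) //.
  by transitivity (\sum_(0 <= d < m) pihomog mdeg d (p : S));
    [rewrite big_mkord | rewrite /index_iota subn0].
- move=> s f us hf e [i|i] di; last exact: (hf (Negz i)).
  have := congr1 (pihomog mdeg i) (e : (_ : S) = 0).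
  rewrite raddf0 raddf_sum /= (bigD1_seq (Posz i)) //= big1 ?addr0.
    by rewrite pihomog_dE //; apply: (hf (Posz i)).
  move=> [j|j] ne; last by rewrite (hf (Negz j)) raddf0.
  apply: (@pihomog_ne0 _ _ mdeg j); last exact: (hf (Posz j)).
  by apply: contraNneq ne => ->.
Qed.

Lemma poly_fg : fin_gen (S^o : lmodType S).
Proof.
exists [:: 1] => x; exists (fun _ => x).
by rewrite big_ord1 /= /GRing.scale /= mulr1.
Qed.

Definition gpoly : gmod := GMod poly_grading poly_fg.

Definition hideal := gsub gpoly.

End FreeModule.

Section LinearForms.
Variable M : gmod.

Definition linform (c : 'rV[k]_n) : S := \sum_i c 0 i *: 'X_i.

Lemma linform_homog c : linform c \is 1.-homog.
Proof.
apply: rpred_sum => i _; apply: rpredZ; rewrite dhomogX; apply/eqP; exact: mdeg1.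
Qed.

Definition lmul_mem (c : 'rV[k]_n) (z : M) : Prop := exists w, z = linform c *: w.

Lemma lmul_submod c : submodule (lmul_mem c).
Proof.
split; first by exists 0; rewrite scaler0.
move=> p _ _ [x ->] [y ->]; exists (p *: x + y).
by rewrite scalerDr !scalerA [p * _]mulrC.
Qed.

Lemma lmul_homog c (s : seq int) (f : int -> M) :
  uniq s -> (forall d, gr d (f d)) -> lmul_mem c (\sum_(d <- s) f d) ->
  forall d, d \in s -> lmul_mem c (f d).
Proof.
move=> us hf [w e] d ds.
have [s2 [g [us2 hg ew]]] := gr_span (gm_grading M) w.
have us3 : uniq [seq z + 1 | z <- s2] by rewrite map_inj_uniq //; apply: addIr.
have hg' := gr_shift (linform_homog c) hg.
have e' : \sum_(d <- s) f d =
    \sum_(d <- [seq z + 1 | z <- s2]) linform c *: g (d - 1%:Z).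
  rewrite e ew scaler_sumr big_map; apply: eq_bigr => z _.
  by rewrite addrK.
rewrite (gr_sub_eq us us3 hf hg' e' ds); case: ifP => _.
  by exists (g (d - 1%:Z)).
by exists 0; rewrite scaler0.
Qed.

Definition lmul (c : 'rV[k]_n) : gsub M := GSub (lmul_submod c) (@lmul_homog c).

End LinearForms.

Section Torsion.
Variable M : gmod.

Definition gamma_mem (z : M) : Prop :=
  exists t0, forall t, (t0 <= t)%N ->
    forall p, ideal_pow (@irrelevant k n) t p -> p *: z = 0.

Lemma gamma_submod : submodule gamma_mem.
Proof.
split; first by exists 0%N => t _ p _; rewrite scaler0.
move=> p x y [t1 h1] [t2 h2]; exists (maxn t1 t2) => t.
rewrite geq_max => /andP[l1 l2] q hq.
by rewrite scalerDr scalerA mulrC -scalerA (h1 _ l1) // (h2 _ l2) // scaler0 addr0.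
Qed.

Lemma ann_ideal (q : S) (z : M) : ideal (fun g => (g * q) *: z = 0).
Proof.
split; first by rewrite mul0r scale0r.
move=> p x y hx hy; rewrite mulrDl scalerDl hy addr0.
by rewrite -[(p *: x) * q]/((p * x) * q) -mulrA -scalerA hx scaler0.
Qed.

Lemma irrelevant_prod_kill (s : seq S) (z : M) :
  (forall g, g \in s -> irrelevant g) ->
  (forall l : seq 'I_n, size l = size s -> (\prod_(i <- l) 'X_i : S) *: z = 0) ->
  (\prod_(g <- s) g) *: z = 0.
Proof.
elim: s z => [|g s IH] z hs hl.
  by have := hl [::] erefl; rewrite !big_nil.
rewrite big_cons; set P := \prod_(j <- s) j.
apply: (hs g (mem_head _ _) (fun g => (g * P) *: z = 0)) => [|_ [i ->]].
  exact: ann_ideal.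
rewrite mulrC -scalerA; apply: IH => [g' hg'|l hlen].
  by apply: hs; rewrite inE hg' orbT.
rewrite scalerA mulrC.
by have := hl (i :: l); rewrite big_cons /= hlen => ->.
Qed.

Lemma gamma_homog (s : seq int) (f : int -> M) :
  uniq s -> (forall d, gr d (f d)) -> gamma_mem (\sum_(d <- s) f d) ->
  forall d, d \in s -> gamma_mem (f d).
Proof.
move=> us hf [t0 h] d ds; exists t0 => t lt p hp.
apply: (hp (fun q => q *: f d = 0)) => {p hp}.
  have [h0 h1] := ann_ideal 1 (f d).
  split=> [|q x y hx hy]; first by rewrite scale0r.
  by have := h1 q x y; rewrite !mulr1; apply.
move=> _ [s' [hsz hs' ->]]; subst t.
apply: irrelevant_prod_kill => // l hl.
have hq : (\prod_(i <- l) 'X_i : S) \is (size s').-homog.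
  rewrite -hl; elim: l {hl} => [|i l IH]; first by rewrite big_nil; apply: dhomog1.
  rewrite big_cons -[size _]/(1 + size l)%N; apply: dhomogM => //; rewrite dhomogX; apply/eqP; exact: mdeg1.
have e : \sum_(d <- [seq z + (size s')%:Z | z <- s])
    (\prod_(i <- l) 'X_i : S) *: f (d - (size s')%:Z) = 0.
  rewrite big_map; under eq_bigr => z _ do rewrite addrK.
  rewrite -scaler_sumr; apply: (h _ lt) => I hI; apply.
  exists [seq 'X_i | i <- l]; split; rewrite ?size_map ?big_map //.
  by move=> g /mapP[i _ ->] I' hI'; apply; exists i.
have us' : uniq [seq z + (size s')%:Z | z <- s] by rewrite map_inj_uniq //; apply: addIr.
have := gr_indep (gm_grading M) us' (gr_shift hq hf) e (d := d + (size s')%:Z).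
by rewrite addrK; apply; apply: map_f.
Qed.

Definition gamma : gsub M := GSub gamma_submod gamma_homog.

End Torsion.

Section Invariants.
Variable M : gmod.

(** Length of the submodule [L]: the maximal length of a strict chain of
    submodules of [L]. *)
Definition length_is (L : M -> Prop) (l : nat) : Prop :=
  is_max (fun l => exists N : nat -> M -> Prop,
    [/\ forall i, submodule (N i),
        forall i x, N i x -> L x &
        forall i, (i < l)%N -> strict_incl (N i) (N i.+1)]) l.

Definition annihilator (p : S) : Prop := forall x : M, p *: x = 0.

(** Krull dimension of [S / ann M]; the zero module has no dimension. *)
Definition dim_is (d : nat) : Prop :=
  is_max (fun d => exists P : nat -> S -> Prop,
    [/\ forall i, prime_ideal (P i),
        forall p, annihilator p -> P 0%N p &
        forall i, (i < d)%N -> strict_incl (P i) (P i.+1)]) d.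

Definition regular_on (f : S) : Prop := forall z : M, f *: z = 0 -> z = 0.

Definition seq_mul (s : seq S) (z : M) : Prop :=
  exists w : 'I_(size s) -> M, z = \sum_(i < size s) s`_i *: w i.

(** Properness [s M <> M] is part of the definition, so the zero module has no
    depth. *)
Definition regular_seq (s : seq S) : Prop :=
  [/\ forall f, f \in s -> irrelevant f,
      forall i z, (i < size s)%N ->
        seq_mul (take i s) (s`_i *: z) -> seq_mul (take i s) z &
      exists z, ~ seq_mul s z].

Definition has_regular_seq (d : nat) : Prop :=
  exists2 s, size s = d & regular_seq s.

Definition depth_is (d : nat) : Prop := is_max has_regular_seq d.

Definition depth_pos : Prop := exists2 d, (0 < d)%N & has_regular_seq d.

(** The zero module is Cohen-Macaulay by convention. *)
Definition cohen_macaulay : Prop :=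
  (forall x : M, x = 0) \/ exists2 d, dim_is d & depth_is d.

(** [h] is the dimension over [k] of the degree-[t] component. *)
Definition hilbert_is (t : int) (h : nat) : Prop :=
  exists v : 'I_h -> M, (forall i, gr t (v i)) /\
    forall z, gr t z ->
      exists! c : 'rV[k]_h, z = \sum_i (c 0 i)%:MP *: v i.

Definition hilbert_poly (P : {poly rat}) : Prop :=
  exists t0 : int, forall t, (t0 <= t)%R ->
    exists2 h, hilbert_is t h & P.[t%:~R] = h%:R.

(** Multiplicity: the length in dimension [<= 0], and otherwise [(d-1)!]
    times the leading coefficient of the Hilbert polynomial, which has degree
    [d - 1]. *)
Definition mult_is (e : nat) : Prop :=
  (((forall x : M, x = 0) \/ dim_is 0) /\ length_is (fun _ => True) e) \/
  exists d P, [/\ (0 < d)%N, dim_is d, hilbert_poly P, size P = d &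
    e%:R = (d.-1)`!%:R * lead_coef P].

End Invariants.

Definition zariski_open (N : nat) (W : 'rV[k]_N -> Prop) : Prop :=
  exists F : {mpoly k[N]} -> Prop,
    forall c, W c <-> exists2 f, F f & f.@[c 0] != 0.

(** [S_1] is identified with [k^n] through [linform]. *)
Record genericity (U : gmod -> 'rV[k]_n -> Prop) : Prop := Genericity {
  genericity_iso : forall M N, gmod_iso M N -> forall c, U M c <-> U N c;
  genericity_open : forall M, exists W : 'rV[k]_n -> Prop,
    [/\ zariski_open W, exists c, W c & forall c, W c -> U M c];
  genericity_regular : forall M, depth_pos M ->
    forall c, U M c -> regular_on M (linform c) }.

Definition is_bdeg (b : gmod -> nat) : Prop :=
  (forall M N, gmod_iso M N -> b M = b N) /\
  exists2 U, genericity U &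
    [/\ forall M e, cohen_macaulay M -> mult_is M e -> b M = e,
        forall M l, length_is (gamma M) l ->
          b M = (b (gquot (gamma M)) + l)%N &
        forall M c, depth_pos M -> U M c -> b M = b (gquot (lmul M c))].

End GradedModules.

Section GenericInitialIdeal.
Variables (k : fieldType) (n : nat).
Local Notation S := {mpoly k[n]}.

Definition rlex_gt (m1 m2 : 'X_{1..n}) : bool :=
  (mdeg m2 < mdeg m1)%N ||
  ((mdeg m1 == mdeg m2) &&
   [exists j : 'I_n, [forall i : 'I_n, (j < i)%N ==> (m1 i == m2 i)] &&
                     (m1 j < m2 j)%N]).

Definition is_lead_term (f g : S) : Prop :=
  exists m : 'X_{1..n}, [/\ m \in msupp f,
    forall m', m' \in msupp f -> m' != m -> rlex_gt m m' &
    g = f@_m *: 'X_[m]].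

Definition initial_ideal (I : S -> Prop) : S -> Prop :=
  ideal_gen (fun g => exists2 f, I f & is_lead_term f g).

(** The action of [s] on [S]: ['X_j] is sent to [\sum_i s i j *: 'X_i]. *)
Definition lin_change (s : 'M[k]_n) (f : S) : S :=
  f \mPo [tuple \sum_i s i j *: 'X_i | j < n].

Definition lin_change_ideal (s : 'M[k]_n) (I : S -> Prop) (g : S) : Prop :=
  exists2 f, I f & g = lin_change s f.

(** Open subsets of [GL_n] are traces of open subsets of the matrix space. *)
Definition is_gin (I J : hideal k n) : Prop :=
  exists W : 'rV[k]_(n * n) -> Prop,
    [/\ zariski_open W,
        exists2 s, s \in unitmx & W (mxvec s) &
        forall s, s \in unitmx -> W (mxvec s) ->
          forall f, J f <-> initial_ideal (lin_change_ideal s I) f].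

End GenericInitialIdeal.

(* Main.v *)
Require Import Defs.
From mathcomp Require Import all_boot all_order all_algebra.
From mathcomp Require Import boolp mpoly zify.

(** Unwinding the axioms along generic linear forms [z_1, ..., z_n], with
    [I_0 = I] and [I_(j+1) = sat I_j + (z_(j+1))], gives
    [bdeg (S/I) = \sum_j length (sat I_j / I_j)]. Move the [z_j] to the variables
    [x_n, ..., x_1] by a linear change [s]. In the reverse lexicographic order
    both [_ : x_q ^ oo] and [_ + (x_q)] commute with taking initial ideals, so
    the sum depends only on the initial ideal of [s I], which is [gin I] for
    generic [s]. The same computation for [gin I] itself yields the same sum as
    soon as [gin (gin I) = gin I]; this holds because the ranks of the
    projections of [s (gin I)_d] to spans of monomials are lower semicontinuous
    in [s] and [gin I] is a limit of translates of [I] under a torus. *)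

Set Implicit Arguments.
Unset Strict Implicit.
Unset Printing Implicit Defensive.

Import GRing.Theory.
Local Open Scope ring_scope.

(** * The reverse lexicographic order *)

Section Rlex.
Variable n : nat.
Implicit Types m u v : 'X_{1..n}.

(** The genericity set of each quotient is known only after the earlier forms have been chosen, so
    the admissible tuples of forms do not come as one open set. The forms are therefore the rows of
    an invertible matrix kept inside a set where the initial ideal is already the generic one, and
    each step moves a single row along a line. Every genericity condition is accordingly tested on
    polynomial curves in one parameter, where it fails at finitely many points; characteristic zero
    serves to make [k] infinite. Lengths are numbers of leading monomials, so the whole sum becomes
    a function of the initial ideal ([beta]). Semicontinuity takes the form of counting inequalities
    over up-sets of the order: [dominated K E] bounds every coordinate change of [K] by [E]. For the
    generic initial ideal this bound is inherited from [I] by degeneration and attained at the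
    identity matrix. *)

Definition wt (B : nat) m : nat := \sum_(i < n) m i * B ^ i.

(** Read [wt B m] as a numeral in base [B] whose leading digit is the exponent of the last variable.
    At the deciding index the digit of [m] is smaller, and the lower digits cannot make up for it
    because their sum is less than [B]. *)
Lemma rlex_gt_wt B m u : mdeg m = mdeg u -> (mdeg m < B)%N ->
  rlex_gt m u -> (wt B m < wt B u)%N.
Proof.
move=> e lB; rewrite /rlex_gt e ltnn eqxx /= => /existsP[j /andP[/forallP hj lj]].
have B0 : (0 < B)%N by exact: leq_ltn_trans lB.
have split (w : 'X_{1..n}) : wt B w =
    (\sum_(i < n | (i < j)%N) w i * B ^ i + w j * B ^ j +
     \sum_(i < n | (j < i)%N) w i * B ^ i)%N.
  rewrite /wt (bigID (fun i : 'I_n => (i < j)%N)) /= -addnA; congr addn.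
  rewrite (bigD1 j) ?ltnn //=; congr addn; apply: eq_bigl => i.
  by rewrite -leqNgt ltn_neqAle eq_sym andbC (inj_eq val_inj).
rewrite !split (eq_bigr (fun i : 'I_n => u i * B ^ i)%N (P := fun i : 'I_n => (j < i)%N)); last first.
  by move=> i ji; have := hj i; rewrite ji /= => /eqP ->.
rewrite ltn_add2r.
have low : (\sum_(i < n | (i < j)%N) m i * B ^ i < B ^ j)%N.
  have [j0|j0] := posnP j.
    by rewrite big_pred0 ?expn_gt0 ?B0 // => i; rewrite j0.
  apply: (@leq_ltn_trans (mdeg m * B ^ j.-1)).
    rewrite mdegE big_distrl /=.
    rewrite [X in (_ <= X)%N](bigID (fun i : 'I_n => (i < j)%N)) /=.
    apply: leq_trans (leq_addr _ _).
    by apply: leq_sum => i ij; rewrite leq_mul2l leq_pexp2l ?orbT // -ltnS prednK.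
  by rewrite -[X in (_ < B ^ X)%N](prednK j0) expnS ltn_pmul2r ?expn_gt0 ?B0.
apply: (@leq_trans (B ^ j + m j * B ^ j)); first by rewrite ltn_add2r.
rewrite -mulSn; apply: leq_trans (leq_addl _ _).
by rewrite leq_mul2r lj orbT.
Qed.

Lemma rlex_total m u : m != u -> rlex_gt m u || rlex_gt u m.
Proof.
move=> ne; rewrite /rlex_gt.
have [l|l|e] := ltngtP (mdeg m) (mdeg u); rewrite ?orbT //=.
have [i0 hi0] : exists i, m i != u i.
  apply/existsP; apply: contraNT ne; rewrite negb_exists => /forallP h.
  by apply/eqP/mnmP => i; apply/eqP; have := h i; rewrite negbK.
case: (@arg_maxnP _ i0 (fun i => m i != u i) (fun i => val i) hi0) => j hj mj.
have agr (i : 'I_n) : (j < i)%N -> m i = u i.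
  by move=> ji; apply/eqP; apply: contraTT ji => /mj; rewrite -leqNgt.
have [l|l|e'] := ltngtP (m j) (u j); last by rewrite e' eqxx in hj.
  apply/orP; left; apply/existsP; exists j; rewrite l andbT.
  by apply/forallP => i; apply/implyP => /agr ->.
apply/orP; right; apply/existsP; exists j; rewrite l andbT.
by apply/forallP => i; apply/implyP => /agr ->.
Qed.

(** Among monomials of degree less than [B], comparing base-[B] expansions
    turns [rlex_gt] into the order of the additive weight [key B]. *)
Definition key (B : nat) m : nat := \sum_(i < n) m i * (B ^ n - B ^ i).

Lemma keyD B m u : key B (m + u)%MM = (key B m + key B u)%N.
Proof.
by rewrite /key -big_split; apply: eq_bigr => i _; rewrite mnmDE mulnDl.
Qed.

Lemma key_wt B m : (0 < B)%N -> (key B m + wt B m)%N = (mdeg m * B ^ n)%N.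
Proof.
move=> B0; rewrite /key /wt -big_split mdegE big_distrl /=.
apply: eq_bigr => i _; rewrite -mulnDr subnK //.
by apply: leq_pexp2l => //; apply: ltnW.
Qed.

(** With [key_wt], this lets one unit of degree, worth [B ^ n], outweigh any difference in [wt]. *)
Lemma wt_lt B m : (mdeg m < B)%N -> (wt B m < B ^ n)%N.
Proof.
move=> lB; have B0 : (0 < B)%N by exact: leq_ltn_trans lB.
have [n0|n0] := posnP n.
  rewrite /wt big1 ?expn_gt0 ?B0 // => i; have := ltn_ord i; by rewrite {2}n0.
apply: (@leq_ltn_trans (mdeg m * B ^ n.-1)).
  rewrite mdegE big_distrl /=.
  by apply: leq_sum => i _; rewrite leq_mul2l leq_pexp2l ?orbT // -ltnS prednK.
by rewrite -[X in (_ < B ^ X)%N](prednK n0) expnS ltn_pmul2r ?expn_gt0 ?B0.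
Qed.

Lemma rlex_gt_key B m u : (mdeg m < B)%N -> (mdeg u < B)%N ->
  rlex_gt m u -> (key B u < key B m)%N.
Proof.
move=> lm lu h; have B0 : (0 < B)%N by exact: leq_ltn_trans lm.
have km := key_wt m B0; have ku := key_wt u B0.
have [l|l|e] := ltngtP (mdeg m) (mdeg u).
- by move: h; rewrite /rlex_gt ltnNge (ltnW l) (ltn_eqF l).
- have := wt_lt lm; have : ((mdeg u).+1 * B ^ n <= mdeg m * B ^ n)%N
    by rewrite leq_mul2r l orbT.
  rewrite mulSn; lia.
- have := rlex_gt_wt e lm h; rewrite e in km; lia.
Qed.

Lemma rlex_keyE B m u : (mdeg m < B)%N -> (mdeg u < B)%N ->
  rlex_gt m u = (key B u < key B m)%N.
Proof.
move=> lm lu; apply/idP/idP; first exact: rlex_gt_key.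
move=> l; have ne : m != u by apply: contraTneq l => ->; rewrite ltnn.
case/orP: (rlex_total ne) => // /(rlex_gt_key lu lm) l'.
by rewrite ltnNge (ltnW l') in l.
Qed.

Lemma rlex_irr m : rlex_gt m m = false.
Proof. by rewrite (@rlex_keyE (mdeg m).+1) ?ltnS ?ltnn. Qed.

Lemma rlex_trans m1 m2 m3 : rlex_gt m1 m2 -> rlex_gt m2 m3 -> rlex_gt m1 m3.
Proof.
pose B := (maxn (mdeg m1) (maxn (mdeg m2) (mdeg m3))).+1.
have [h1 h2 h3] : [/\ mdeg m1 < B, mdeg m2 < B & mdeg m3 < B]%N.
  by rewrite /B !ltnS; split; lia.
by rewrite !(@rlex_keyE B) // => a b; apply: ltn_trans a.
Qed.

Lemma rlex_asym m u : rlex_gt m u -> rlex_gt u m = false.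
Proof. by move=> h; apply/negP => /(rlex_trans h); rewrite rlex_irr. Qed.

Lemma rlex_addE m u v : rlex_gt (v + m)%MM (v + u)%MM = rlex_gt m u.
Proof.
pose B := (mdeg v + maxn (mdeg m) (mdeg u)).+1.
by rewrite !(@rlex_keyE B) ?mdegD ?keyD ?ltn_add2l // /B; lia.
Qed.

Lemma rlex_mdeg m u : rlex_gt m u -> (mdeg u <= mdeg m)%N.
Proof. by case/orP => [/ltnW|/andP[/eqP->]]. Qed.

(** Going down never raises the degree, so one base [B] serves for the whole descent, along which
    [key B] decreases. *)
Lemma rlex_ind (P : 'X_{1..n} -> Prop) :
  (forall m, (forall u, rlex_gt m u -> P u) -> P m) -> forall m, P m.
Proof.
move=> H m; pose B := (mdeg m).+1.
have lm : (mdeg m < B)%N by [].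
move: lm; move: B => B; have [N leN] := ubnP (key B m).
elim: N m leN => // N IH m leN lm; apply: H => u hu.
have lu : (mdeg u < B)%N by apply: leq_ltn_trans lm; apply: rlex_mdeg.
by apply: IH => //; move: hu; rewrite (@rlex_keyE B) //; lia.
Qed.

(** This and [rlex_last_le] are the features of the order behind [lmset_addz] and [lmset_colinf]. *)
Lemma rlex_last0 m u (p q : 'I_n) : mdeg m = mdeg u ->
  (forall i : 'I_n, (p <= i)%N -> m i = 0%N) -> (p <= q)%N -> (0 < u q)%N ->
  rlex_gt m u.
Proof.
move=> e m0 pq uq.
have ne : m != u by apply: contraTneq uq => <-; rewrite m0.
case/orP: (rlex_total ne) => //.
rewrite /rlex_gt e ltnn eqxx /= => /existsP[j /andP[/forallP hj lj]].
have jp : (j < p)%N by rewrite ltnNge; apply/negP => /m0 z; rewrite z in lj.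
have := hj q; rewrite (leq_trans jp pq) m0 // => /= /eqP z.
by rewrite z in uq.
Qed.

Lemma rlex_last_le m u (p : 'I_n) : mdeg m = mdeg u -> rlex_gt m u ->
  (forall i : 'I_n, (p < i)%N -> m i = 0%N /\ u i = 0%N) -> (m p <= u p)%N.
Proof.
move=> e h z; rewrite leqNgt; apply/negP => lt.
suff : rlex_gt u m by rewrite rlex_asym.
move: h; rewrite /rlex_gt e ltnn eqxx /= => _.
apply/existsP; exists p; rewrite lt andbT; apply/forallP => i.
by apply/implyP => /z[-> ->].
Qed.

End Rlex.

(** * Leading monomials and initial ideals *)

Section Leads.
Variables (k : fieldType) (n : nat).
Local Notation S := {mpoly k[n]}.
Implicit Types (f g h p q x y : S) (m u v : 'X_{1..n}) (V I K : S -> Prop).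

Definition subspace V := V 0 /\ forall (c : k) x y, V x -> V y -> V (c *: x + y).

Definition lead f m := f@_m != 0 /\ forall u, rlex_gt u m -> f@_u = 0.

(** The exponents of the initial ideal when [V] is an ideal; graded pieces [Vd K d] are treated in
    the same way. *)
Definition lmset V m := exists2 f, V f & lead f m.

Definition upset (E : 'X_{1..n} -> Prop) := forall m u, E m -> E (u + m)%MM.

Section Subspace.
Variables (V : S -> Prop) (hV : subspace V).

Lemma subspace0 : V 0. Proof. by case: hV. Qed.
Lemma subspaceD x y : V x -> V y -> V (x + y).
Proof. by move=> hx hy; rewrite -[x]scale1r; apply: hV.2. Qed.
Lemma subspaceZ c x : V x -> V (c *: x).
Proof. by move=> hx; rewrite -[_ *: x]addr0; apply: hV.2 => //; exact: subspace0. Qed.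
Lemma subspaceN x : V x -> V (- x).
Proof. by move=> hx; rewrite -scaleN1r; apply: subspaceZ. Qed.
Lemma subspaceB x y : V x -> V y -> V (x - y).
Proof. by move=> hx hy; apply: subspaceD => //; apply: subspaceN. Qed.
Lemma subspace_sum (T : Type) (r : seq T) (P : pred T) (F : T -> S) :
  (forall i, P i -> V (F i)) -> V (\sum_(i <- r | P i) F i).
Proof. by move=> h; apply: big_ind => //; [exact: subspace0 | exact: subspaceD]. Qed.
Lemma subspace_sum_seq (T : eqType) (r : seq T) (F : T -> S) :
  (forall i, i \in r -> V (F i)) -> V (\sum_(i <- r) F i).
Proof. by move=> h; rewrite big_seq; apply: subspace_sum. Qed.

End Subspace.

Lemma ideal0 I : ideal I -> I 0. Proof. by case. Qed.
Lemma ideal_mull I p x : ideal I -> I x -> I (p * x).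
Proof. by move=> [h0 h] hx; rewrite -[p * x]addr0; apply: h. Qed.
Lemma ideal_mulr I p x : ideal I -> I x -> I (x * p).
Proof. by rewrite mulrC; apply: ideal_mull. Qed.
Lemma idealD I x y : ideal I -> I x -> I y -> I (x + y).
Proof. by move=> [h0 h] hx hy; rewrite -[x]mul1r; apply: (h 1). Qed.

Lemma idealI I : I 0 -> (forall p x, I x -> I (p * x)) ->
  (forall x y, I x -> I y -> I (x + y)) -> ideal I.
Proof. by move=> h0 hM hD; split=> // p x y hx hy; apply: hD => //; apply: hM. Qed.

Lemma ideal_subspace I : ideal I -> subspace I.
Proof.
move=> hI; split; first exact: ideal0.
move=> c x y hx hy; apply: idealD => //; rewrite -mul_mpolyC; exact: ideal_mull.
Qed.

Lemma rlex_max (s : seq 'X_{1..n}) : s != [::] ->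
  exists2 m, m \in s & forall u, u \in s -> rlex_gt u m = false.
Proof.
elim: s => // a s IH _; have [->|/IH[m ms hm]] := eqVneq s [::].
  by exists a; rewrite ?inE // => u; rewrite inE => /eqP ->; rewrite rlex_irr.
case am : (rlex_gt a m).
  exists a; rewrite ?mem_head // => u; rewrite inE => /orP[/eqP->|/hm h].
    by rewrite rlex_irr.
  by apply/negP => /rlex_trans/(_ am); rewrite h.
exists m; first by rewrite inE ms orbT.
by move=> u; rewrite inE => /orP[/eqP->|/hm].
Qed.

Lemma lead_exists f : f != 0 -> exists m, lead f m.
Proof.
rewrite -msupp_eq0 => /rlex_max[m ms hm]; exists m; split.
  by rewrite -mcoeff_msupp.
by move=> u um; apply/eqP; rewrite mcoeff_eq0; apply/negP => /hm; rewrite um.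
Qed.

Lemma lead_neq0 f m : lead f m -> f != 0.
Proof. by case=> h _; apply: contraNneq h => ->; rewrite mcoeff0. Qed.

Lemma lead_le f m u : lead f m -> f@_u != 0 -> u != m -> rlex_gt m u.
Proof.
move=> [_ h] fu um; case/orP: (rlex_total um) => // /h e.
by rewrite e eqxx in fu.
Qed.

Lemma lead_below h m : h@_m = 0 -> (forall u, rlex_gt u m -> h@_u = 0) ->
  h = 0 \/ exists2 u, lead h u & rlex_gt m u.
Proof.
move=> hm hu; have [->|/lead_exists[u lu]] := eqVneq h 0; first by left.
right; exists u => //; have um : u != m.
  by apply: contraTneq lu.1 => ->; rewrite hm eqxx.
by case/orP: (rlex_total um) => // /hu e; have := lu.1; rewrite e eqxx.
Qed.

Lemma lead_cancel f g m : lead f m -> lead g m ->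
  let h := f - (f@_m / g@_m) *: g in
  h = 0 \/ exists2 u, lead h u & rlex_gt m u.
Proof.
move=> [fm fu] [gm gu] h; apply: (@lead_below h m).
  by rewrite /h mcoeffB mcoeffZ divfK // subrr.
by move=> u um; rewrite /h mcoeffB mcoeffZ (fu _ um) (gu _ um) mulr0 subr0.
Qed.

Lemma lead_mulX f m u : lead f m -> lead ('X_[u] * f) (u + m)%MM.
Proof.
move=> hf; split; first by rewrite mulrC mcoeffMX hf.1.
move=> w hw; apply: contraTeq hw => hw.
have : w \in msupp (f * 'X_[u]) by rewrite mcoeff_msupp mulrC.
rewrite (perm_mem (msuppMX _ _)) => /mapP[v fv ->].
rewrite rlex_addE; have [->|vm] := eqVneq v m; first by rewrite rlex_irr.
by rewrite rlex_asym // (lead_le hf) // -mcoeff_msupp.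
Qed.

Lemma lmset_ideal_up I : ideal I -> upset (lmset I).
Proof.
move=> hI m u [f If lf]; exists ('X_[u] * f); first exact: ideal_mull.
exact: lead_mulX.
Qed.

Lemma lmset_le V V' m : (forall f, V f -> V' f) -> lmset V m -> lmset V' m.
Proof. by move=> h [f /h ? ?]; exists f. Qed.

(** Division by [V]: a leading monomial that occurs in [V] can be cancelled, and [rlex_ind] ends the
    process. It cannot end at zero since [x] is outside [V]. *)
Lemma reduce V x : subspace V -> ~ V x ->
  exists2 y, V (x - y) & exists2 m, lead y m & ~ lmset V m.
Proof.
move=> hV Vx; have x0 : x != 0 by apply/eqP => e; apply: Vx; rewrite e; exact: subspace0.
have [m lm] := lead_exists x0; elim/rlex_ind: m => m IH in x x0 Vx lm *.
have [[f Vf lf]|] := EM (lmset V m); last first.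
  by move=> h; exists x; [rewrite subrr; exact: subspace0 | exists m].
have := lead_cancel lm lf; set c := _ / _ => /= -[e|[u lu mu]].
  by case: Vx; rewrite -(subrK (c *: f) x) e add0r; apply: subspaceZ.
have [||y hy1 hy2] := IH u mu (x - c *: f) _ _ lu; first exact: lead_neq0 lu.
  by move=> h; apply: Vx; rewrite -(subrK (c *: f) x); apply: subspaceD => //; apply: subspaceZ.
exists y => //; have -> : x - y = (x - c *: f - y) + c *: f by rewrite addrAC subrK.
by apply: subspaceD => //; apply: subspaceZ.
Qed.

(** A nonzero remainder modulo [V] would lie in [V'] with a leading monomial that [V] lacks. Both
    Noetherianity and the computation of lengths rest on this criterion. *)
Lemma lmset_full V V' : subspace V -> subspace V' -> (forall f, V f -> V' f) ->
  (forall m, lmset V' m -> lmset V m) -> forall f, V' f -> V f.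
Proof.
move=> hV hV' sub hl f V'f; apply: contrapT => /(reduce hV)[y Vy [m ly]]; apply.
apply: hl; exists y => //; rewrite -(subKr f y).
by apply: subspaceB => //; apply: sub.
Qed.

Lemma mon_ideal_closed (E : 'X_{1..n} -> Prop) : upset E ->
  ideal (fun f => forall m, f@_m != 0 -> E m).
Proof.
move=> hE; apply: idealI.
- by move=> m; rewrite mcoeff0 eqxx.
- move=> p x hx m; rewrite -mcoeff_msupp => /msuppM_le/allpairsP[[a b] /= [_ hb ->]].
  by apply: hE; apply: hx; rewrite -mcoeff_msupp.
- move=> x y hx hy m; rewrite mcoeffD => h.
  have [e|] := eqVneq x@_m 0; last exact: hx.
  by apply: hy; rewrite e add0r in h.
Qed.

Lemma lead_termP f g : is_lead_term f g <->
  exists2 m, lead f m & g = f@_m *: 'X_[m].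
Proof.
split=> [[m [ms h ->]]|[m lm ->]].
  exists m => //; split; first by rewrite -mcoeff_msupp.
  move=> u um; apply/eqP; apply: contraT => fu.
  have ne : u != m by apply: contraTneq um => ->; rewrite rlex_irr.
  by have := h u; rewrite mcoeff_msupp fu ne => /(_ isT isT)/rlex_asym; rewrite um.
exists m; split=> //; first by rewrite mcoeff_msupp lm.1.
by move=> u; rewrite mcoeff_msupp; apply: lead_le.
Qed.

(** The leading exponents of an ideal form an up-set for divisibility, so the polynomials supported
    on them already form an ideal. *)
Lemma initial_idealP I f : ideal I ->
  initial_ideal I f <-> forall m, f@_m != 0 -> lmset I m.
Proof.
move=> hI; split.
  move/(_ (fun f => forall m, f@_m != 0 -> lmset I m)); apply.
    exact/mon_ideal_closed/lmset_ideal_up.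
  move=> g [h Ih /lead_termP[m lm ->]] u; rewrite mcoeffZ mcoeffX.
  by have [<-|_] := eqVneq m u; [exists h | rewrite mulr0 eqxx].
move=> h J hJ hJg; rewrite (mpolyE f); apply: subspace_sum_seq; first exact: ideal_subspace.
move=> m; rewrite mcoeff_msupp => /h[g Ig lg].
have : J (g@_m *: 'X_[m]) by apply: hJg; exists g => //; apply/lead_termP; exists m.
move/(subspaceZ (ideal_subspace hJ) (f@_m / g@_m)).
by rewrite scalerA divfK // lg.1.
Qed.

Lemma mcoeff_pihomog d f m :
  (pihomog mdeg d f)@_m = if mdeg m == d then f@_m else 0.
Proof.
rewrite {2}(mpolyE f) pihomogE !raddf_sum /= -big_filter.
rewrite big_filter big_mkcond /=; have [e|ne] := eqVneq (mdeg m) d.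
  apply: eq_bigr => u _; case: eqP => // ne; rewrite mcoeffZ mcoeffX.
  by have [eu|] := eqVneq u m; [rewrite eu in ne | rewrite mulr0].
rewrite big1 // => u _; case: eqP => // eu; rewrite mcoeffZ mcoeffX.
by have [e|] := eqVneq u m; [rewrite -eu e eqxx in ne | rewrite mulr0].
Qed.

(** A bare predicate, so that saturations, sums and coordinate changes need no repackaging as
    [hideal]. *)
Definition hid K := ideal K /\ forall d f, K f -> K (pihomog mdeg d f).

Definition Vd K (d : nat) f := K f /\ f \is d.-homog.

Lemma Vd_subspace K d : ideal K -> subspace (Vd K d).
Proof.
move=> hK; have hV := ideal_subspace hK; split.
  by split; [exact: subspace0 | exact: rpred0].
move=> c x y [hx dx] [hy dy]; split; first by apply: hV.2.
by apply: rpredD => //; apply: rpredZ.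
Qed.

Lemma lead_pihomog f m : lead f m -> lead (pihomog mdeg (mdeg m) f) m.
Proof.
move=> [fm fu]; split; first by rewrite mcoeff_pihomog eqxx.
by move=> u /fu e; rewrite mcoeff_pihomog e if_same.
Qed.

Lemma lmset_homog K m : hid K -> lmset K m ->
  exists f, [/\ K f, f \is (mdeg m).-homog & lead f m].
Proof.
move=> [_ hK] [f Kf lf]; exists (pihomog mdeg (mdeg m) f); split.
- exact: hK.
- exact: pihomogP.
- exact: lead_pihomog.
Qed.

Lemma homog_mcoeff d f m : f \is d.-homog -> f@_m != 0 -> mdeg m = d.
Proof. by move=> hf fm; apply: (dhomog_mf hf); rewrite mcoeff_msupp. Qed.

Lemma homogX u : ('X_[u] : S) \is (mdeg u).-homog.
Proof. by rewrite dhomogX. Qed.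

Lemma pihomog_decomp f : f = \sum_(d < msize f) pihomog mdeg d f.
Proof. by rewrite -pihomog_partitionE. Qed.

End Leads.

(** * Noetherianity and saturation *)

Lemma incr_ltn (phi : nat -> nat) : (forall i, (phi i < phi i.+1)%N) ->
  forall i j, (i < j)%N -> (phi i < phi j)%N.
Proof.
move=> h i j; elim: j => // j IH; rewrite ltnS leq_eqVlt => /orP[/eqP->//|/IH].
by move/ltn_trans; apply.
Qed.

Lemma nondecr_subseq (f : nat -> nat) : exists phi : nat -> nat,
  (forall i, (phi i < phi i.+1)%N) /\
  forall i j, (i <= j)%N -> (f (phi i) <= f (phi j))%N.
Proof.
have H N : exists a, (N <= a)%N /\ forall b, (N <= b)%N -> (f a <= f b)%N.
  have ex : exists v, `[< exists2 a, (N <= a)%N & f a = v >].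
    by exists (f N); apply/asboolP; exists N.
  case: (ex_minnP ex) => v /asboolP[a Na fa] hv; exists a; split=> // b Nb.
  by rewrite fa; apply: hv; apply/asboolP; exists b.
have [g hg] := choice H.
pose phi := fix phi i := if i is j.+1 then g (phi j).+1 else g 0%N.
have inc i : (phi i < phi i.+1)%N by exact: (hg (phi i).+1).1.
exists phi; split=> // i j; elim: j => [|j IH]; first by rewrite leqn0 => /eqP ->.
rewrite leq_eqVlt => /orP[/eqP->//|]; rewrite ltnS => /IH h.
apply: leq_trans h _; case: j {IH} => [|j]; first exact: (hg 0%N).2.
exact: (hg (phi j).+1).2 (ltn_trans (inc j) (inc j.+1)).
Qed.

Section Noetherian.
Variables (k : fieldType) (n : nat).
Local Notation S := {mpoly k[n]}.
Implicit Types (f g h p q x y : S) (m u v : 'X_{1..n}) (V I K : S -> Prop).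

(** Thin out the sequence once per variable until every coordinate is nondecreasing; the first two
    terms then compare. *)
Lemma mnm_wqo (s : nat -> 'X_{1..n}) :
  exists i j, (i < j)%N /\ (s i <= s j)%MM.
Proof.
suff H (l : seq 'I_n) : exists phi : nat -> nat, (forall i, (phi i < phi i.+1)%N) /\
    forall c, c \in l -> forall i j, (i <= j)%N -> (s (phi i) c <= s (phi j) c)%N.
  have [phi [inc hphi]] := H (enum 'I_n).
  exists (phi 0%N), (phi 1%N); split=> //; apply/mnm_lepP => c.
  by apply: hphi => //; rewrite mem_enum.
elim: l => [|c l [phi [inc hphi]]]; first by exists id.
have [psi [inc' hpsi]] := nondecr_subseq (fun i => s (phi i) c).
exists (phi \o psi); split=> [i|c']; first exact: (incr_ltn inc).
rewrite inE => /orP[/eqP->|cl] i j ij /=; first exact: hpsi.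
apply: hphi => //; move: ij; rewrite leq_eqVlt => /orP[/eqP->//|ij].
exact/ltnW/(incr_ltn inc').
Qed.

(** If no finite list sufficed, one could keep choosing elements of [E] divisible by none of the
    earlier ones, against [mnm_wqo]. *)
Lemma dickson (E : 'X_{1..n} -> Prop) : exists s : seq 'X_{1..n},
  (forall u, u \in s -> E u) /\ forall m, E m -> exists2 u, u \in s & (u <= m)%MM.
Proof.
apply: contrapT => H.
have next (s : seq 'X_{1..n}) : exists m, (forall u, u \in s -> E u) ->
    E m /\ forall u, u \in s -> ~~ (u <= m)%MM.
  apply: contrapT => h; apply: H; exists s.
  have hs : forall u, u \in s -> E u.
    apply: contrapT => hs; apply: h; exists 0%MM => h'; case: hs; exact: h'.
  split=> // m Em; apply: contrapT => hm; apply: h; exists m => _; split=> // u us.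
  by apply/negP => um; apply: hm; exists u.
have [g hg] := choice next.
pose s := fix s i := if i is j.+1 then g (s j) :: s j else [::].
have sE i : forall u, u \in s i -> E u.
  elim: i => // i IH u; rewrite /= inE => /orP[/eqP->|]; last exact: IH.
  by have [] := hg _ IH.
have mem i j : (i < j)%N -> g (s i) \in s j.
  elim: j => // j IH; rewrite ltnS leq_eqVlt => /orP[/eqP->|/IH h].
    exact: mem_head.
  by rewrite inE h orbT.
have [i [j [ij le]]] := mnm_wqo (fun i => g (s i)).
by have [_ /(_ _ (mem _ _ ij))] := hg _ (sE j); rewrite le.
Qed.

(** The basis theorem in the form of maximal elements. Each strict enlargement brings a new leading
    monomial by [lmset_full]; by [mnm_wqo] one of these is a multiple of an earlier one, hence was
    not new. *)
Lemma ideal_max (F : (S -> Prop) -> Prop) K0 :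
  (forall K, F K -> ideal K) -> F K0 ->
  exists K, [/\ F K, forall x, K0 x -> K x &
    forall K', F K' -> (forall x, K x -> K' x) -> forall x, K' x -> K x].
Proof.
move=> Fid FK0; apply: contrapT => H.
pose T K := F K /\ forall x, K0 x -> K x.
have next K : exists K', T K -> [/\ T K', forall x, K x -> K' x &
    exists2 m, lmset K' m & ~ lmset K m].
  have [[FK KK]|nT] := EM (T K); last by exists K.
  apply: contrapT => h; apply: H; exists K; split=> // K' FK' sub.
  apply: lmset_full => //; try by apply: ideal_subspace; apply: Fid.
  move=> m hm; apply: contrapT => hm'; apply: h; exists K' => _; split=> //.
    by split=> // x /KK/sub.
  by exists m.
have [g hg] := choice next.
pose s i := iter i g K0.
have sT i : T (s i) by elim: i => // i IH; have [] := hg _ IH.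
have sle i j : (i <= j)%N -> forall x, s i x -> s j x.
  elim: j => [|j IH]; first by rewrite leqn0 => /eqP ->.
  rewrite leq_eqVlt => /orP[/eqP->//|/IH h] x /h hx.
  by have [_ hs _] := hg _ (sT j); apply: hs.
have /choice[m hm] : forall i, exists m, lmset (s i.+1) m /\ ~ lmset (s i) m.
  by move=> i; have [_ _ [m ? ?]] := hg _ (sT i); exists m.
have [i [j [ij le]]] := mnm_wqo m.
case: (hm j).2; rewrite -(submK le); apply: lmset_ideal_up.
  by apply: Fid; case: (sT j).
apply: lmset_le (hm i).1; exact: sle.
Qed.

(** The colon ideal [K : m ^ t], with [m ^ t] replaced by the forms of degree at least [t] that span
    it. *)
Definition tors K t x := forall d p, (t <= d)%N -> p \is d.-homog -> K (p * x).

Definition sat K x := exists t, tors K t x.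

Lemma tors_le K t t' x : (t <= t')%N -> tors K t x -> tors K t' x.
Proof. by move=> le h d p /(leq_trans le); apply: h. Qed.

Lemma tors_ideal K t : ideal K -> ideal (tors K t).
Proof.
move=> hK; apply: idealI => [d p _ _|p x h d q td hq|x y hx hy d p td hp].
- by rewrite mulr0; apply: ideal0.
- by rewrite mulrCA; apply: ideal_mull => //; apply: (h d).
- by rewrite mulrDr; apply: idealD => //; [apply: (hx d) | apply: (hy d)].
Qed.

Lemma sub_tors K t x : ideal K -> K x -> tors K t x.
Proof. by move=> hK Kx d p _ _; apply: ideal_mull. Qed.

Lemma sat_uniform K : ideal K -> exists N, forall x, sat K x -> tors K N x.
Proof.
move=> hK.
have [_ [[N ->] _ hN]] := @ideal_max (fun K' => exists N, K' = tors K N)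
  (tors K 0) (fun K' e => let: ex_intro N e := e in eq_ind_r _ (tors_ideal N hK) e)
  (ex_intro _ 0%N erefl).
exists N => x [t hx]; apply: (hN (tors K (maxn t N))); first by exists (maxn t N).
  by move=> y; apply: tors_le; rewrite leq_maxr.
by apply: tors_le hx; rewrite leq_maxl.
Qed.

Lemma sat_ideal K : ideal K -> ideal (sat K).
Proof.
move=> hK; apply: idealI.
- by exists 0%N; exact (ideal0 (tors_ideal 0 hK)).
- by move=> p x [t h]; exists t; exact (ideal_mull p (tors_ideal t hK) h).
- move=> x y [t hx] [t' hy]; exists (maxn t t').
  apply: (idealD (tors_ideal (maxn t t') hK)).
  + by apply: tors_le hx; rewrite leq_maxl.
  + by apply: tors_le hy; rewrite leq_maxr.
Qed.

Lemma sub_sat K x : ideal K -> K x -> sat K x.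
Proof. by exists 0%N; apply: sub_tors. Qed.

Lemma mul_X_homog K x t : ideal K ->
  (forall u, (t <= mdeg u)%N -> K ('X_[u] * x)) -> tors K t x.
Proof.
move=> hK h d p td hp; rewrite (mpolyE p) mulr_suml.
apply: subspace_sum_seq; first exact: ideal_subspace.
move=> m ms; rewrite -scalerAl; apply: subspaceZ; first exact: ideal_subspace.
by apply: h; rewrite (dhomog_mf hp ms).
Qed.

Lemma mnm_pos_split u : (0 < mdeg u)%N -> exists i v, u = (U_(i) + v)%MM.
Proof.
rewrite lt0n mdeg_eq0 => u0.
have [i ui] : exists i, u i != 0%N.
  apply/existsP; apply: contraNT u0; rewrite negb_exists => /forallP h.
  by apply/eqP/mnmP => i; rewrite mnm0E; have := h i; rewrite negbK => /eqP.
by exists i, (u - U_(i))%MM; rewrite addmC submK // lep1mP.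
Qed.

Lemma tors1 K x : ideal K -> (forall i, K ('X_i * x)) -> tors K 1 x.
Proof.
move=> hK h; apply: mul_X_homog => // u /mnm_pos_split[i [v ->]].
by rewrite mpolyXD mulrAC mulrC; apply: ideal_mull.
Qed.

Lemma sat_sat K x : ideal K -> tors (sat K) 1 x -> sat K x.
Proof.
(* One variable carries [x] into [sat K], and [N] further factors carry any element of [sat K] into
   [K]. *)
move=> hK h; have [N hN] := sat_uniform hK; exists N.+1.
apply: mul_X_homog => // u; rewrite -addn1 => hu.
have /mnm_pos_split[i [v e]] : (0 < mdeg u)%N by lia.
have hv : (N <= mdeg v)%N by move: hu; rewrite e mdegD mdeg1; lia.
rewrite e mpolyXD mulrAC mulrC; apply: (hN _ _ _ _ hv (homogX _ _)).
by apply: (h 1%N) => //; rewrite dhomogX; apply/eqP; exact: mdeg1.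
Qed.

End Noetherian.

(** * Length of a quotient of ideals *)

Definition mons n D : seq 'X_{1..n} := [seq bmnm u | u <- enum {: 'X_{1..n < D}}].

Lemma mem_mons n D (m : 'X_{1..n}) : (m \in mons n D) = (mdeg m < D)%N.
Proof.
apply/mapP/idP => [[u _ ->]|lm]; first exact: bmdeg.
by exists (BMultinom lm); rewrite ?mem_enum.
Qed.

Lemma mons_uniq n D : uniq (mons n D).
Proof. by rewrite map_inj_uniq ?enum_uniq //; apply: val_inj. Qed.

Definition enumerates (T : eqType) (s : seq T) (P : T -> Prop) :=
  uniq s /\ forall x, x \in s <-> P x.

Lemma enumerates_size (T : eqType) (s s' : seq T) (P P' : T -> Prop) :
  enumerates s P -> enumerates s' P' -> (forall x, P x <-> P' x) -> size s = size s'.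
Proof.
move=> [us hs] [us' hs'] e; apply/perm_size/uniq_perm => // x.
by apply/idP/idP => [/hs/e/hs'|/hs'/e/hs].
Qed.

Lemma bounded_enumerates n D (P : 'X_{1..n} -> Prop) :
  (forall m, P m -> (mdeg m < D)%N) -> exists s, enumerates s P.
Proof.
move=> hP; exists [seq m <- mons n D | `[< P m >]]; split.
  by rewrite filter_uniq // mons_uniq.
move=> m; rewrite mem_filter mem_mons; split=> [/andP[/asboolP]//|Pm].
by rewrite hP // andbT; apply/asboolP.
Qed.

Section Length.
Variables (k : fieldType) (n : nat).
Local Notation S := {mpoly k[n]}.
Implicit Types (f g h p q x y : S) (m u v : 'X_{1..n}) (V I K B : S -> Prop).

Definition chain K B l (N : nat -> S -> Prop) :=
  [/\ forall i, ideal (N i), forall i x, K x -> N i x, forall i x, N i x -> B x &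
      forall i, (i < l)%N -> strict_incl (N i) (N i.+1)].

Definition idl_len K B := is_max (fun l => exists N, chain K B l N).

(** For [K] inside [B], these monomials index a basis of [B / K]; in [idl_len_exists] their number
    becomes its length. *)
Definition lmdiff K B m := lmset B m /\ ~ lmset K m.

Lemma lmdiff_exists K B : ideal K -> ideal B -> strict_incl K B ->
  exists m, lmdiff K B m.
Proof.
move=> hK hB [sub [x [Bx Kx]]]; apply: contrapT => h; apply: Kx.
apply: (lmset_full (ideal_subspace hK) (ideal_subspace hB) sub) Bx => m hm.
by apply: contrapT => hm'; apply: h; exists m.
Qed.

(** Every strict inclusion adds a leading monomial, and those added at different steps are
    distinct. *)
Lemma chain_le_size K B l N s : chain K B l N ->
  (forall m, lmdiff K B m -> m \in s) -> (l <= size s)%N.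
Proof.
move=> [Nid KN NB strict] hs.
have mono i j : (i <= j <= l)%N -> forall x, N i x -> N j x.
  elim: j => [|j IH]; first by rewrite leqn0 => /andP[/eqP ->].
  case/andP; rewrite leq_eqVlt => /orP[/eqP->//|ij] jl x Nx.
  by apply: (strict j jl).1; apply: IH Nx; rewrite -ltnS ij ltnW.
have /choice[m hm] : forall i, exists m, (i < l)%N -> lmdiff (N i) (N i.+1) m.
  move=> i; have [il|_] := boolP (i < l)%N; last by exists 0%MM.
  by have [m hm] := lmdiff_exists (Nid i) (Nid i.+1) (strict i il); exists m.
have neq i j : (i < j < l)%N -> m i != m j.
  case/andP=> ij jl; apply/eqP => e; apply: (hm j jl).2; rewrite -e.
  apply: lmset_le (hm i (ltn_trans ij jl)).1; apply: mono; by rewrite ij ltnW.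
rewrite -[l](size_iota 0) -(size_map m); apply: uniq_leq_size.
  rewrite map_inj_in_uniq ?iota_uniq // => i j; rewrite !mem_iota /= add0n => il jl e.
  have [ij|ij|//] := ltngtP i j.
    by have := neq i j; rewrite ij jl e eqxx => /(_ isT).
  by have := neq j i; rewrite ij il e eqxx => /(_ isT).
move=> w /mapP[i]; rewrite mem_iota /= add0n => il ->; apply: hs.
have [h1 h2] := hm i il; split; first by apply: lmset_le h1; apply: NB.
by move=> h; apply: h2; apply: lmset_le h; apply: KN.
Qed.

(** If [N] is the least exponent that works, some form [p] of degree at least [N - 1] has [p * x]
    outside [K], and every further form of positive degree brings it into [K]. *)
Lemma socle_exists K B N x0 : ideal B -> B x0 -> ~ K x0 ->
  (forall x, B x -> tors K N x) -> exists2 x, B x & ~ K x /\ tors K 1 x.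
Proof.
move=> hB Bx0 Kx0; elim: N => [|N IH] h.
  by case: Kx0; rewrite -[x0]mul1r; apply: (h x0 Bx0 0%N) => //; apply: dhomog1.
have [/IH//|] := EM (forall x, B x -> tors K N x).
move=> /existsNP[x /not_implyP[Bx /existsNP[d /existsNP[p /not_implyP[Nd]]]]].
move=> /not_implyP[hp Kpx]; exists (p * x); first exact: ideal_mull.
split=> // e q e1 hq; rewrite mulrA; apply: (h x Bx (e + d)%N).
  by rewrite -add1n leq_add.
exact: dhomogM.
Qed.

Definition adjoin K x y := exists c : k, K (y - c *: x).

(** On a socle element, [p] acts modulo [K] as its constant coefficient, so adding a single line is
    enough. *)
Lemma adjoin_ideal K x : ideal K -> tors K 1 x -> ideal (adjoin K x).
Proof.
move=> hK hx; have sK := ideal_subspace hK; apply: idealI.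
- by exists 0; rewrite scale0r subrr; exact: ideal0.
- move=> p y [c hc]; exists (c * p@_0%MM).
  have -> : p * y - (c * p@_0%MM) *: x =
      p * (y - c *: x) + c *: ((p - (p@_0%MM)%:MP) * x).
    rewrite mulrBr mulrBl scalerBr -scalerA -scalerAr mul_mpolyC.
    by rewrite addrA subrK.
  apply: subspaceD => //; first exact: ideal_mull.
  apply: subspaceZ => //; rewrite (mpolyE (_ - _)) mulr_suml; apply: subspace_sum_seq => // u.
  rewrite mcoeff_msupp mcoeffB mcoeffC => hu; rewrite -scalerAl; apply: subspaceZ => //.
  apply: (hx (mdeg u)); last exact: homogX.
  rewrite lt0n mdeg_eq0; apply: contraNneq hu => ->.
  by rewrite eqxx mulr1 subrr.
- move=> y z [c hc] [d hd]; exists (c + d).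
  by rewrite scalerDl opprD addrACA; apply: idealD.
Qed.

(** In [y = z + c *: x] with [z] in [K], the leading monomials of [z] and [x] differ, so nothing
    cancels at the top. *)
Lemma lmset_adjoin K x m u : ideal K -> lead x m -> ~ lmset K m ->
  lmset (adjoin K x) u <-> (u = m \/ lmset K u).
Proof.
move=> hK lx Km; have sK := ideal_subspace hK; split; last first.
  case=> [->|[y Ky ly]]; last by exists y => //; exists 0; rewrite scale0r subr0.
  by exists x => //; exists 1; rewrite scale1r subrr; exact: ideal0.
move=> [y [c hc] ly]; have [c0|c0] := eqVneq c 0.
  by right; exists y => //; rewrite c0 scale0r subr0 in hc.
have [->|um] := eqVneq u m; [by left | right].
set z := y - c *: x in hc; case/orP: (rlex_total um) => [gt|gt].
  exists z => //; split=> [|w wu]; rewrite mcoeffB mcoeffZ.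
    by rewrite (lx.2 _ gt) mulr0 subr0 ly.1.
  by rewrite (ly.2 _ wu) (lx.2 _ (rlex_trans wu gt)) mulr0 subr0.
case: Km; exists z => //; split=> [|w wm]; rewrite mcoeffB mcoeffZ.
  by rewrite (ly.2 _ gt) sub0r oppr_eq0 mulf_neq0 // lx.1.
by rewrite (lx.2 _ wm) (ly.2 _ (rlex_trans wm gt)) mulr0 subr0.
Qed.

(** Induction on the number of monomials: adjoin a socle element, first reduced modulo [K] so that
    its leading monomial is new; exactly one entry leaves the list. *)
Lemma chain_exists K B N s : ideal K -> ideal B -> (forall x, K x -> B x) ->
  (forall x, B x -> tors K N x) -> enumerates s (lmdiff K B) ->
  exists C, chain K B (size s) C.
Proof.
move=> hK hB KB tB; have [r] := ubnP (size s).
elim: r K s hK KB tB => // r IH K s hK KB tB; case: s => [|m0 s] /=.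
  by move=> _ _; exists (fun=> K); split.
rewrite ltnS => sr [/= us hs].
have [[x0 Bx0 lx0] Km0] : lmdiff K B m0 by apply/hs; exact: mem_head.
have Kx0 : ~ K x0 by move=> Kx0; apply: Km0; exists x0.
have [x Bx [Kx tx]] := socle_exists hB Bx0 Kx0 tB.
have sK := ideal_subspace hK; have sB := ideal_subspace hB.
have [y Kxy [m ly Km]] := reduce sK Kx.
have By : B y by rewrite -(subKr x y); apply: subspaceB => //; apply: KB.
have ty : tors K 1 y.
  rewrite -(subKr x y); have st := ideal_subspace (tors_ideal 1 hK).
  by apply: (subspaceB st tx); exact: sub_tors.
pose K' := adjoin K y; have hK' : ideal K' by exact: adjoin_ideal.
have KK' z : K z -> K' z by exists 0; rewrite scale0r subr0.
have K'B z : K' z -> B z.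
  by move=> [c /KB h]; rewrite -(subrK (c *: y) z); apply: subspaceD => //; apply: subspaceZ.
have ms : m \in m0 :: s by apply/hs; split=> //; exists y.
have hs' : enumerates (rem m (m0 :: s)) (lmdiff K' B).
  split=> [|u]; first exact: rem_uniq.
  rewrite mem_rem_uniq // inE /=; split=> [/andP[um /hs[h1 h2]]|[h1 h2]].
    by split=> // /(lmset_adjoin u hK ly Km)[e|//]; rewrite e eqxx in um.
  have ad := lmset_adjoin u hK ly Km; apply/andP; split.
    by apply/eqP => e; apply: h2; apply/ad; left.
  by apply/hs; split=> // h; apply: h2; apply/ad; right.
have sz : size (rem m (m0 :: s)) = size s by rewrite size_rem.
have [||C [Cid KC CB st]] := IH K' (rem m (m0 :: s)) hK' K'B _ _ hs'.
- by move=> z Bz d p dN hp; apply/KK'/(tB z Bz d).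
- by rewrite sz.
exists (fun i => if i is j.+1 then C j else K); split.
- by case.
- by case=> // i z /KK'; apply: KC.
- by case=> // i z; apply: CB.
- case=> [_|i]; last by rewrite ltnS => il; apply: st; rewrite sz.
  split=> [z /KK'|]; first exact: KC.
  exists y; split; first by apply: KC; exists 1; rewrite scale1r subrr; exact: ideal0.
  by move=> Ky; apply: Km; exists y.
Qed.

Lemma lmdiff_finite K B N : ideal K ->
  (forall x, B x -> tors K N x) -> exists s, enumerates s (lmdiff K B).
Proof.
move=> hK tB; have [s [sB hs]] := dickson (lmset B).
(* Dickson generators of the leading monomials of [B] have bounded degree, and multiplying by degree
   [N] or more lands in [K]. *)
apply: (@bounded_enumerates _ (\max_(u <- s) mdeg u + N).+1) => m [Bm Km].
have [u us um] := hs m Bm; rewrite ltnS leqNgt; apply/negP => h; apply: Km.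
have [f Bf lf] := sB u us; rewrite -(submK um); exists ('X_[m - u] * f).
  apply: (tB f Bf (mdeg (m - u)%MM)); last exact: homogX.
  have le : (mdeg u <= \max_(u <- s) mdeg u)%N by exact: leq_bigmax_seq.
  rewrite -(leq_add2l (mdeg u)) -mdegD addmC submK //.
  by apply: leq_trans (ltnW h); rewrite leq_add2r.
exact: lead_mulX.
Qed.

Lemma idl_len_exists K B N : ideal K -> ideal B -> (forall x, K x -> B x) ->
  (forall x, B x -> tors K N x) ->
  exists s, enumerates s (lmdiff K B) /\ idl_len K B (size s).
Proof.
move=> hK hB KB tB; have [s hs] := lmdiff_finite hK tB.
exists s; split=> //; split; first exact: chain_exists tB hs.
by move=> l [C hC]; apply: (chain_le_size hC) => m hm; exact/(hs.2 m).
Qed.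

Lemma is_max_uniq (P : nat -> Prop) a b : is_max P a -> is_max P b -> a = b.
Proof.
by move=> [Pa ha] [Pb hb]; apply/eqP; rewrite eqn_leq ha // hb.
Qed.

End Length.

(** * Regular linear forms *)

Section Cofinite.
Variable k : fieldType.

(** Containing a nonempty open subset of the affine line: the exceptions are among the roots of one
    nonzero polynomial. *)
Definition cofin (P : k -> Prop) := exists2 r : {poly k}, r != 0 &
  forall t, r.[t] != 0 -> P t.

Lemma cofin_and P Q : cofin P -> cofin Q -> cofin (fun t => P t /\ Q t).
Proof.
move=> [r r0 hr] [s s0 hs]; exists (r * s); first exact: mulf_neq0.
by move=> t; rewrite hornerM mulf_eq0 negb_or => /andP[/hr ? /hs ?].
Qed.

Lemma cofin_mono (P Q : k -> Prop) : (forall t, P t -> Q t) -> cofin P -> cofin Q.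
Proof. by move=> PQ [r r0 hr]; exists r => // t /hr/PQ. Qed.

Lemma cofin_all (P : k -> Prop) : (forall t, P t) -> cofin P.
Proof. by exists 1 => //; exact: oner_neq0. Qed.

Lemma cofin_neq a : cofin (fun t => t != a).
Proof.
exists ('X - a%:P); first by rewrite polyXsubC_eq0.
by move=> t; rewrite hornerXsubC subr_eq0.
Qed.

Lemma cofin_forall (T : eqType) (s : seq T) (P : T -> k -> Prop) :
  (forall x, x \in s -> cofin (P x)) -> cofin (fun t => forall x, x \in s -> P x t).
Proof.
elim: s => [|a s IH] h; first exact: cofin_all.
have h1 : cofin (P a) by apply: h; exact: mem_head.
have h2 : cofin (fun t => forall x, x \in s -> P x t).
  by apply: IH => x xs; apply: h; rewrite inE xs orbT.
apply: cofin_mono (cofin_and h1 h2) => t [Pa Ps] x.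
by rewrite inE => /orP[/eqP->|/Ps].
Qed.

(** Characteristic zero enters here: the images of [0, ..., size r - 1] are distinct, one more than
    [r] can have as roots. *)
Lemma cofin_exists (P : k -> Prop) : [pchar k] =i pred0 -> cofin P -> exists t, P t.
Proof.
move=> hk [r r0 hr]; apply: contrapT => hP.
pose s := [seq (i%:R : k) | i <- iota 0 (size r)].
have us : uniq s.
  have inj (a b : nat) : (a <= b)%N -> a%:R = b%:R :> k -> a = b.
    move=> ab e; have : (b - a)%:R == 0 :> k by rewrite natrB // e subrr.
    by move/pcharf0P: hk => ->; rewrite subn_eq0 => ba; apply/eqP; rewrite eqn_leq ab.
  rewrite map_inj_in_uniq ?iota_uniq // => a b _ _ e.
  by case/orP: (leq_total a b) => h; [|symmetry]; apply: inj.
have : all (root r) s.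
  by apply/allP => t _; apply/contraT => rt; case: hP; exists t; apply: hr.
by move/(max_poly_roots r0)/(_ us); rewrite size_map size_iota ltnn.
Qed.

End Cofinite.

Section Regular.
Variables (k : fieldType) (n : nat).
Hypothesis hk : [pchar k] =i pred0.
Local Notation S := {mpoly k[n]}.
Implicit Types (f g h p q x y : S) (V I K B : S -> Prop).

Lemma linform_lin (t : k) (c d : 'rV[k]_n) :
  linform (c + t *: d) = linform c + t *: linform d.
Proof.
rewrite /linform scaler_sumr -big_split; apply: eq_bigr => i _ /=.
by rewrite !mxE scalerDl scalerA.
Qed.

Lemma linform_delta i : linform (delta_mx 0 i) = 'X_i :> S.
Proof.
rewrite /linform (bigD1 i) //= big1 ?addr0; first by rewrite mxE !eqxx scale1r.
by move=> j ji; rewrite mxE (negPf ji) andbF scale0r.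
Qed.

(** Two points of the line in [V] would put its direction, and then the whole line, into [V]. *)
Lemma linform_cofin V c d : subspace V -> ~ V (linform c) ->
  cofin (fun t => ~ V (linform (c + t *: d))).
Proof.
move=> hV Vc; have [[t1 h1]|h] := EM (exists t1, V (linform (c + t1 *: d))); last first.
  by apply: cofin_all => t ht; apply: h; exists t.
apply: cofin_mono (cofin_neq t1) => t tt1 ht; apply: Vc.
have : V ((t - t1) *: linform d).
  by move: (subspaceB hV ht h1); rewrite !linform_lin opprD addrACA subrr add0r -scalerBl.
move/(subspaceZ hV (t1 / (t - t1))); rewrite scalerA divfK ?subr_eq0 // => h2.
by move: (subspaceB hV h1 h2); rewrite linform_lin addrK.
Qed.

(** A vector space over an infinite field is not a finite union of proper subspaces: join a form
    that avoids the new subspace to one that avoids all the others. *)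
Lemma linform_avoid (T : eqType) (s : seq T) (V : T -> S -> Prop) :
  (forall a, a \in s -> subspace (V a) /\ exists c, ~ V a (linform c)) ->
  exists c, forall a, a \in s -> ~ V a (linform c).
Proof.
elim: s => [|a s IH] h; first by exists 0.
have [c hc] : exists c, forall b, b \in s -> ~ V b (linform c).
  by apply: IH => b bs; apply: h; rewrite inE bs orbT.
have [sa [c1 hc1]] := h a (mem_head _ _).
have c1s : cofin (fun t => ~ V a (linform (c1 + t *: (c - c1)))).
  exact: linform_cofin.
have cs : cofin (fun t => forall b, b \in s -> ~ V b (linform (c + t *: (c1 - c)))).
  apply: cofin_forall => b bs; apply: linform_cofin; last exact: hc.
  by have [] := h b; rewrite ?inE ?bs ?orbT.
have cs' : cofin (fun t => ~ V a (linform (c + t *: (c1 - c)))).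
  (* [linform_cofin] wants its base point outside [V a], so the line was run backwards; [t] is now
     replaced by [1 - t]. *)
  case: c1s => r r0 hr; exists (r \Po (1 - 'X)).
    have e : r = (r \Po (1 - 'X)) \Po (1 - 'X).
      rewrite -comp_polyA; rewrite comp_polyB comp_polyX comp_polyC.
      by rewrite opprB addrC subrK comp_polyXr.
    by apply: contraNneq r0 => z; rewrite e z comp_poly0.
  move=> t; rewrite horner_comp hornerD hornerN hornerX hornerC => /hr.
  suff -> : c1 + (1 - t) *: (c - c1) = c + t *: (c1 - c) by [].
  by rewrite scalerBl scale1r -scalerN opprB addrA subrKC.
have [t [h1 h2]] := cofin_exists hk (cofin_and cs cs').
by exists (c + t *: (c1 - c)) => b; rewrite inE => /orP[/eqP->|/h1].
Qed.

Definition ann K g p := K (p * g).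

Lemma ann_idealK K g : ideal K -> ideal (ann K g).
Proof.
move=> hK; apply: idealI => [|p x hx|x y hx hy]; rewrite /ann.
- by rewrite mul0r; apply: ideal0.
- by rewrite -mulrA; apply: ideal_mull.
- by rewrite mulrDl; apply: idealD.
Qed.

(** Then [ann K g] is an associated prime of [S / K]; its primality is [max_ann_prime]. *)
Definition max_ann K g := ~ K g /\ forall g', ~ K g' ->
  (forall p, ann K g p -> ann K g' p) -> forall p, ann K g' p -> ann K g p.

Lemma max_ann_exists K f : ideal K -> ~ K f ->
  exists2 g, max_ann K g & forall p, ann K f p -> ann K g p.
Proof.
move=> hK Kf.
have [|_ [[g Kg ->] fg hg]] := @ideal_max _ _
    (fun I => exists2 g, ~ K g & I = ann K g) (ann K f) _ (ex_intro2 _ _ f Kf erefl).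
  by move=> _ [g _ ->]; apply: ann_idealK.
exists g => //; split=> // g' Kg' sub; apply: hg => //; by exists g'.
Qed.

Lemma max_ann_prime K g a b : ideal K -> max_ann K g ->
  ann K g (a * b) -> ~ ann K g b -> ann K g a.
Proof.
move=> hK [Kg hg] hab hb; apply: (hg (b * g)) => //.
  by move=> p; rewrite /ann mulrCA; apply: ideal_mull.
by rewrite /ann mulrA.
Qed.

Lemma max_ann_avoid K g (s : seq S) : ideal K -> max_ann K g ->
  (forall h, h \in s -> exists2 a, ann K h a & ~ ann K g a) ->
  exists2 a, (forall h, h \in s -> ann K h a) & ~ ann K g a.
Proof.
move=> hK hg; elim: s => [|h s IH] hs.
  by exists 1 => //; rewrite /ann mul1r; case: hg.
have [a ha ga] := hs h (mem_head _ _).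
have [|b hb gb] := IH; first by move=> x xs; apply: hs; rewrite inE xs orbT.
exists (a * b); last by move/(max_ann_prime hK hg)/(_ gb).
move=> x; rewrite inE => /orP[/eqP->|/hb hx].
  exact (ideal_mulr b (ann_idealK h hK) ha).
exact (ideal_mull a (ann_idealK x hK) hx).
Qed.

(** Otherwise each linear form lies in a maximal annihilator; choosing linear
    forms outside the annihilators found so far produces an infinite strictly
    increasing chain of ideals. *)
Lemma regular_linform K : ideal K -> (forall x, tors K 1 x -> K x) -> ~ K 1 ->
  exists c : 'rV[k]_n, forall f, K (linform c * f) -> K f.
Proof.
move=> hK satK K1; apply: contrapT => H.
have zd (c : 'rV_n) : exists2 f, ~ K f & K (linform c * f).
  apply: contrapT => h; apply: H; exists c => f Kcf; apply: contrapT => Kf.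
  by apply: h; exists f.
pose F I := exists s : seq S, (forall g, g \in s -> max_ann K g) /\
  I = ideal_gen (fun x => K x \/ x \in s).
have gen_ideal (A : S -> Prop) : ideal (ideal_gen A).
  apply: idealI => [I hI _|p x hx I hI AI|x y hx hy I hI AI].
  - exact: ideal0.
  - by apply: ideal_mull => //; apply: hx.
  - by apply: idealD => //; [apply: hx | apply: hy].
have gen_in (A : S -> Prop) x : A x -> ideal_gen A x by move=> Ax I _; apply.
have [||_ [[s [hs ->]] _ smax]] := @ideal_max _ _ F (ideal_gen (fun x => K x \/ x \in [::])).
- by move=> _ [s [_ ->]].
- by exists [::].
have [c hc] : exists c, forall g, g \in s -> ~ ann K g (linform c).
  apply: linform_avoid => g /hs[Kg _]; split; first exact/ideal_subspace/ann_idealK.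
  apply: contrapT => h; apply: Kg; apply: satK; apply: (tors1 hK) => i.
  apply: contrapT => h'; apply: h; exists (delta_mx 0 i).
  by rewrite linform_delta.
have [f Kf Kcf] := zd c.
have [g hg fg] := max_ann_exists hK Kf.
(* By maximality [g] already lies in the ideal generated by [K] and [s], so anything that multiplies
   all of [s] into [K] does the same to [g]; the element [a] below violates this. *)
have gs : ideal_gen (fun x => K x \/ x \in s) g.
  apply: (smax (ideal_gen (fun x => K x \/ x \in g :: s))).
  - exists (g :: s); split=> // x; rewrite inE => /orP[/eqP->//|]; exact: hs.
  - move=> x hx I hI AI; apply: hx => // y [Ky|ys]; apply: AI; first by left.
    by right; rewrite inE ys orbT.
  - by apply: gen_in; right; exact: mem_head.
have [a ha ga] : exists2 a, (forall h, h \in s -> ann K h a) & ~ ann K g a.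
  apply: max_ann_avoid => // h sh; apply: contrapT => no.
  have hg' p : ann K h p -> ann K g p.
    by move=> hp; apply: contrapT => gp; apply: no; exists p.
  apply: (hc h sh); have [_ hm] := hs h sh.
  by apply: (hm g hg.1 hg'); apply: fg.
apply: ga; apply: (gs (fun x => K (a * x))).
  apply: idealI => [|p x|x y hx hy].
  - by rewrite mulr0; apply: ideal0.
  - by rewrite mulrCA; apply: ideal_mull.
  - by rewrite mulrDr; apply: idealD.
by move=> x [Kx|/ha//]; apply: ideal_mull.
Qed.

End Regular.

(** * Adding variables one at a time *)

Section Flags.
Variables (k : fieldType) (n : nat).
Local Notation S := {mpoly k[n]}.
Implicit Types (f g h p x y z : S) (m u : 'X_{1..n}) (V I K B : S -> Prop) (q : 'I_n).

Definition mfilter (P : pred 'X_{1..n}) f : S :=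
  \sum_(u <- msupp f | P u) f@_u *: 'X_[u].

Lemma mcoeff_mfilter P f m : (mfilter P f)@_m = if P m then f@_m else 0.
Proof.
rewrite {2}(mpolyE f) !raddf_sum /= big_mkcond /=; case: ifP => Pm.
  apply: eq_bigr => u _; case: ifP => // Pu; rewrite mcoeffZ mcoeffX.
  by have [e|] := eqVneq u m; [rewrite e Pm in Pu | rewrite mulr0].
rewrite big1 // => u _; case: ifP => // Pu; rewrite mcoeffZ mcoeffX.
by have [e|] := eqVneq u m; [rewrite e Pm in Pu | rewrite mulr0].
Qed.

Lemma mcoeff_mulX_neq0 a g m : ('X_[a] * g)@_m != 0 -> (a <= m)%MM.
Proof.
rewrite -mcoeff_msupp mulrC (perm_mem (msuppMX _ _)) => /mapP[v _ ->].
exact: lem_addr.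
Qed.

Lemma mdivX a p : (forall u, p@_u != 0 -> (a <= u)%MM) ->
  exists g, p = 'X_[a] * g.
Proof.
move=> h; exists (\sum_(u <- msupp p) p@_u *: 'X_[u - a]).
rewrite mulr_sumr {1}(mpolyE p); apply: eq_big_seq => u.
rewrite mcoeff_msupp => /h le.
by rewrite -scalerAr -mpolyXD addmC submK.
Qed.

Lemma lead_divX a g m : lead ('X_[a] * g) (a + m)%MM -> lead g m.
Proof.
move=> [h1 h2]; rewrite mulrC mcoeffMX in h1; split=> // u um.
by have := h2 (a + u)%MM; rewrite mulrC mcoeffMX rlex_addE; apply.
Qed.

Lemma leadX m : lead ('X_[m] : S) m.
Proof.
split; first by rewrite mcoeffX eqxx oner_neq0.
move=> u; rewrite mcoeffX; have [<-|//] := eqVneq m u.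
by rewrite rlex_irr.
Qed.

Lemma pihomogM_eq e d p f : p \is e.-homog ->
  pihomog mdeg (e + d) (p * f) = p * pihomog mdeg d f.
Proof.
move=> hp; set fd := pihomog mdeg d f.
rewrite -{1}(subrK fd f) mulrDr raddfD /=.
rewrite [X in _ + X]pihomog_dE ?dhomogM ?pihomogP //.
rewrite -[RHS]add0r; congr (_ + _); apply/mpolyP => m.
rewrite mcoeff0 mcoeff_pihomog; case: eqP => // em; apply/eqP.
rewrite mcoeff_eq0; apply/negP => /msuppM_le/allpairsP[[a b] /= [ha hb e']].
have ea : mdeg a = e by apply: (dhomog_mf hp).
have eb : mdeg b = d by apply: (@addnI e); rewrite -em e' mdegD ea.
by move: hb; rewrite mcoeff_msupp mcoeffB mcoeff_pihomog eb eqxx subrr eqxx.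
Qed.

Lemma pihomogM_exists e d p f : p \is e.-homog ->
  exists g, pihomog mdeg d (p * f) = p * g.
Proof.
move=> hp; have [le|lt] := leqP e d.
  by exists (pihomog mdeg (d - e) f); rewrite -(@pihomogM_eq e) // subnKC.
exists 0; rewrite mulr0; apply/mpolyP => m.
rewrite mcoeff0 mcoeff_pihomog; case: eqP => // em; apply/eqP.
rewrite mcoeff_eq0; apply/negP => /msuppM_le/allpairsP[[a b] /= [ha _ e']].
have ea : mdeg a = e by apply: (dhomog_mf hp).
by move: lt; rewrite -em e' mdegD ea ltnNge leq_addr.
Qed.

(** The ideal [K : z ^ oo]; [addz K z] is [K + (z)]. *)
Definition colinf K z f := exists t, K (z ^+ t * f).
Definition addz K z f := exists g, K (f - z * g).

Lemma colinf_ideal K z : ideal K -> ideal (colinf K z).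
Proof.
move=> hK; apply: idealI => [|p x [t ht]|x y [s hs] [t ht]].
- by exists 0%N; rewrite mulr0; apply: ideal0.
- by exists t; rewrite mulrCA; apply: ideal_mull.
- exists (s + t)%N; rewrite mulrDr; apply: idealD => //.
    by rewrite addnC exprD -mulrA; apply: ideal_mull.
  by rewrite exprD -mulrA; apply: ideal_mull.
Qed.

Lemma addz_ideal K z : ideal K -> ideal (addz K z).
Proof.
move=> hK; apply: idealI => [|p x [g hg]|x y [g hg] [h hh]].
- by exists 0; rewrite mulr0 subrr; apply: ideal0.
- by exists (p * g); rewrite mulrCA -mulrBr; apply: ideal_mull.
- by exists (g + h); rewrite mulrDr opprD addrACA; apply: idealD.
Qed.

Lemma sub_colinf K z x : K x -> colinf K z x.
Proof. by exists 0%N; rewrite mul1r. Qed.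

Lemma sub_addz K z x : K x -> addz K z x.
Proof. by exists 0; rewrite mulr0 subr0. Qed.

Lemma colinf_hid K z : z \is 1.-homog -> hid K -> hid (colinf K z).
Proof.
move=> hz [hK dK]; split; first exact: colinf_ideal.
move=> d f [t ht]; exists t; rewrite -(@pihomogM_eq t); first exact: dK.
by have := dhomogMn t hz; rewrite mul1n.
Qed.

Lemma addz_hid K z : z \is 1.-homog -> hid K -> hid (addz K z).
Proof.
move=> hz [hK dK]; split; first exact: addz_ideal.
move=> d f [g hg]; have [g' e] := pihomogM_exists d g hz.
by exists g'; rewrite -e -raddfB /=; apply: dK.
Qed.

Lemma homogXi (i : 'I_n) : ('X_i : S) \is 1.-homog.
Proof. by rewrite dhomogX; apply/eqP; exact: mdeg1. Qed.

Lemma lmset_mon K m i : ideal K -> K 'X_i -> (0 < m i)%N -> lmset K m.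
Proof.
move=> hK Ki mi; exists 'X_[m]; last exact: leadX.
by rewrite -(@submK _ U_(i) m) ?lep1mP -?lt0n // mpolyXD; apply: ideal_mull.
Qed.

(** [Einf] and [Enext] mirror [colinf] and [flag_next] on the exponents of initial ideals when [z]
    is the variable [x_q]. *)
Definition Einf (E : 'X_{1..n} -> Prop) q m := exists t, E (m + U_(q) *+ t)%MM.
Definition Enext (E : 'X_{1..n} -> Prop) q m := Einf E q m \/ (0 < m q)%N.

(** With the later variables in [K], [x_q] acts as the last one. Drop from a homogeneous [f] the
    terms containing later variables: if [x_q ^ t] divides the leading monomial, then by
    [rlex_last_le] it divides every remaining term and can be cancelled. *)
Lemma lmset_colinf K q m : hid K -> (forall i : 'I_n, (q < i)%N -> K 'X_i) ->
  lmset (colinf K 'X_q) m <-> Einf (lmset K) q m.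
Proof.
move=> hK Kq; split.
  move=> [f [t Kf] lf]; exists t; exists ('X_q ^+ t * f) => //.
  by rewrite mpolyXn addmC; apply: lead_mulX.
move=> [t hm]; have [f [Kf df lf]] := lmset_homog hK hm.
have [/existsP[i /andP[qi mi]]|] := boolP [exists i : 'I_n, (q < i)%N && (0 < m i)%N].
  apply: (lmset_mon (colinf_ideal _ hK.1) _ mi); apply: sub_colinf; exact: Kq.
rewrite negb_exists => /forallP hm0.
have m0 (i : 'I_n) : (q < i)%N -> m i = 0%N.
  by move=> qi; have := hm0 i; rewrite qi /= -leqNgt leqn0 => /eqP.
pose P u := [forall i : 'I_n, (q < i)%N ==> (u i == 0%N)].
set a := (U_(q) *+ t)%MM in hm df lf *.
have a0 (i : 'I_n) : (q < i)%N -> a i = 0%N.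
  by move=> qi; rewrite mulmnE mnm1E; case: eqP qi => [->|]; rewrite ?ltnn.
have Pma : P (m + a)%MM.
  by apply/forallP => i; apply/implyP => qi; rewrite mnmDE m0 // a0.
have hP u : P u -> f@_u != 0 -> (a <= u)%MM.
  move=> /forallP Pu fu; apply/mnm_lepP => i; rewrite mulmnE mnm1E.
  case: eqP => [<-|_] //=; rewrite mul1n.
  apply: (@leq_trans ((m + a)%MM q)).
    by rewrite mnmDE mulmnE mnm1E eqxx mul1n leq_addl.
  have [->//|ne] := eqVneq u (m + a)%MM.
  apply: rlex_last_le; first by rewrite (homog_mcoeff df fu).
    exact: lead_le lf fu ne.
  move=> j qj; split; first by rewrite mnmDE m0 // a0.
  by have := Pu j; rewrite qj /= => /eqP.
have Kbad : K (f - mfilter P f).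
  rewrite (mpolyE (f - _)); apply: subspace_sum_seq => [|u]; first exact: ideal_subspace hK.1.
  rewrite mcoeff_msupp mcoeffB mcoeff_mfilter; case: ifP => [|nPu _].
    by rewrite subrr eqxx.
  apply: subspaceZ; first exact: ideal_subspace hK.1.
  move/negbT: nPu; rewrite negb_forall => /existsP[i].
  rewrite negb_imply -lt0n => /andP[qi ui].
  rewrite -(@submK _ U_(i) u) ?lep1mP -?lt0n // mpolyXD; apply: ideal_mull hK.1 _.
  exact: Kq.
have Kgood : K (mfilter P f).
  rewrite -(subKr f (mfilter P f)); apply: subspaceB => //; exact: ideal_subspace hK.1.
have [|g eg] := @mdivX a (mfilter P f).
  by move=> u; rewrite mcoeff_mfilter; case: ifP => [Pu|]; [apply: hP | rewrite eqxx].
exists g; first by exists t; rewrite mpolyXn -eg.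
apply: (@lead_divX a); rewrite -eg addmC; split.
  by rewrite mcoeff_mfilter Pma lf.1.
by move=> u um; rewrite mcoeff_mfilter; case: ifP => // _; apply: lf.2.
Qed.

(** If [m] involves neither [x_q] nor a later variable, every monomial of its degree divisible by
    [x_q] is smaller, so subtracting a multiple of [x_q] leaves the leading monomial [m] in
    place. *)
Lemma lmset_addz K q m : hid K -> (forall i : 'I_n, (q < i)%N -> K 'X_i) ->
  lmset (addz K 'X_q) m <-> (lmset K m \/ (0 < m q)%N).
Proof.
move=> hK Kq; split; last first.
  case=> [|mq]; first by apply: lmset_le => f; apply: sub_addz.
  apply: (lmset_mon (addz_ideal _ hK.1) _ mq).
  by exists 1; rewrite mulr1 subrr; apply: ideal0 hK.1.
move=> hm; have [mq|] := posnP (m q); last by right.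
left; have [f [[g Kfg] df lf]] := lmset_homog (addz_hid (homogXi q) hK) hm.
have [/existsP[i /andP[qi mi]]|] := boolP [exists i : 'I_n, (q < i)%N && (0 < m i)%N].
  by apply: (lmset_mon hK.1 _ mi); apply: Kq.
rewrite negb_exists => /forallP hm0.
have m0 (i : 'I_n) : (q <= i)%N -> m i = 0%N.
  rewrite leq_eqVlt => /orP[/eqP/val_inj<-//|qi].
  by have := hm0 i; rewrite qi /= -leqNgt leqn0 => /eqP.
have zq u : u q = 0%N -> ('X_q * g)@_u = 0.
  move=> uq; apply/eqP; apply: contraT => /mcoeff_mulX_neq0/mnm_lepP/(_ q).
  by rewrite mnm1E eqxx uq.
exists (pihomog mdeg (mdeg m) (f - 'X_q * g)); first exact: hK.2.
split; first by rewrite mcoeff_pihomog eqxx mcoeffB zq // subr0 lf.1.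
move=> u um; rewrite mcoeff_pihomog; case: eqP => // eu.
rewrite mcoeffB lf.2 // sub0r zq ?oppr0 //.
apply/eqP; rewrite -leqn0 leqNgt; apply/negP => uq.
have := @rlex_last0 _ m u q q (esym eu) m0 (leqnn _) uq.
by rewrite rlex_asym.
Qed.

Definition flag_next K z := addz (colinf K z) z.

(** [colinf K (z q)] stands for the saturation of [K]; the two agree when
    [z q] is regular modulo the latter. *)
Fixpoint bval (z : 'I_n -> S) (ps : seq 'I_n) K (v : nat) : Prop :=
  if ps is q :: ps' then exists l v', [/\ v = (l + v')%N,
    idl_len K (colinf K (z q)) l,
    exists N, forall x, colinf K (z q) x -> tors K N x &
    bval z ps' (flag_next K (z q)) v']
  else idl_len K (fun=> True) v /\ exists N, forall x, tors K N x.

(** The recursion of [bval] on exponent sets alone, with lengths as numbers of monomials. It is a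
    relation because the sets involved may be infinite. *)
Fixpoint beta (ps : seq 'I_n) (E : 'X_{1..n} -> Prop) (v : nat) : Prop :=
  if ps is q :: ps' then exists s v', [/\ v = (size s + v')%N,
    enumerates s (fun m => Einf E q m /\ ~ E m) & beta ps' (Enext E q) v']
  else exists2 s, v = size s & enumerates s (fun m => ~ E m).

Lemma beta_fun ps E E' v v' : (forall m, E m <-> E' m) ->
  beta ps E v -> beta ps E' v' -> v = v'.
Proof.
elim: ps E E' v v' => [|q ps IH] E E' v v' e /=.
  move=> [s -> hs] [s' -> hs']; apply: enumerates_size hs hs' _ => m.
  by split=> h /e.
have einf m : Einf E q m <-> Einf E' q m by split=> -[t /e h]; exists t.
move=> [s [w [-> hs hw]]] [s' [w' [-> hs' hw']]]; congr addn.
  apply: enumerates_size hs hs' _ => m.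
  by split=> -[/einf h1 h2]; split=> // /e.
apply: IH hw hw' => m; split=> -[/einf h|h]; by [left | right].
Qed.

(** The list is decreasing and contains every variable outside [K], so all variables after its head
    lie in [K], as [lmset_colinf] and [lmset_addz] require. *)
Lemma bval_beta ps K v : hid K -> pairwise (fun i j : 'I_n => j < i)%N ps ->
  (forall i, i \notin ps -> K 'X_i) -> bval (fun i => 'X_i) ps K v ->
  beta ps (lmset K) v.
Proof.
elim: ps K v => [|q ps IH] K v hK /=.
  move=> _ _ [hv [N hN]].
  have hT : ideal (fun _ : S => True) by apply: idealI.
  have [s [hs hl]] := idl_len_exists hK.1 hT (fun _ _ => I) (fun x _ => hN x).
  exists s; first exact: is_max_uniq hv hl.
  split=> [|m]; first exact: hs.1.
  split=> [/hs.2[]//|Km]; apply/hs.2; split=> //.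
  by exists 'X_[m] => //; exact: leadX.
move=> /andP[/allP psq hps] Kps [l [v' [-> hl [N hN] hv']]].
have Kq (i : 'I_n) : (q < i)%N -> K 'X_i.
  move=> qi; apply: Kps; rewrite inE negb_or; apply/andP; split.
    by apply: contraTneq qi => ->; rewrite ltnn.
  by apply/negP => /psq; rewrite ltnNge (ltnW qi).
have hI := colinf_hid (homogXi q) hK.
have [s [hs hls]] := idl_len_exists hK.1 hI.1 (fun x => @sub_colinf K _ x) hN.
exists s, v'; split.
- by congr addn; apply: is_max_uniq hl hls.
- split=> [|m]; first exact: hs.1.
  split=> [/hs.2[/lmset_colinf h1 h2]|[h1 h2]]; first by split=> //; apply: h1.
  by apply/hs.2; split=> //; apply/lmset_colinf.
have hN' : hid (flag_next K 'X_q) by exact: addz_hid (homogXi q) hI.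
have := IH _ _ hN' hps _ hv'.
have Kinf (i : 'I_n) : (q < i)%N -> colinf K 'X_q 'X_i by move/Kq/sub_colinf.
have en m : lmset (flag_next K 'X_q) m <-> Enext (lmset K) q m.
  split=> [/(lmset_addz m hI Kinf)[/lmset_colinf h|]|[h|h]].
  - by left; apply: h.
  - by right.
  - by apply/(lmset_addz m hI Kinf); left; apply/lmset_colinf.
  - by apply/(lmset_addz m hI Kinf); right.
have -> : lmset (flag_next K 'X_q) = Enext (lmset K) q.
  by apply/funext => m; apply/propext.
apply=> i ips; have [->|iq] := eqVneq i q.
  by exists 1; rewrite mulr1 subrr; apply: ideal0 hI.1.
by apply/sub_addz/sub_colinf/Kps; rewrite inE negb_or iq.
Qed.

End Flags.

(** * Linear changes of variables *)

Section LinChange.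
Variables (k : fieldType) (n : nat).
Local Notation S := {mpoly k[n]}.
Implicit Types (f g h p x y z : S) (K B : S -> Prop) (s t : 'M[k]_n).

Lemma lin_changeD s f g : lin_change s (f + g) = lin_change s f + lin_change s g.
Proof. exact: comp_mpolyD. Qed.
Lemma lin_changeB s f g : lin_change s (f - g) = lin_change s f - lin_change s g.
Proof. exact: raddfB. Qed.
Lemma lin_changeZ s c f : lin_change s (c *: f) = c *: lin_change s f.
Proof. exact: comp_mpolyZ. Qed.
Lemma lin_changeM s f g : lin_change s (f * g) = lin_change s f * lin_change s g.
Proof. exact: rmorphM. Qed.
Lemma lin_change1 s : lin_change s 1 = 1.
Proof. exact: comp_mpoly1. Qed.
Lemma lin_change0 s : lin_change s 0 = 0.
Proof. exact: comp_mpoly0. Qed.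
Lemma lin_change_exp s f i : lin_change s (f ^+ i) = lin_change s f ^+ i.
Proof. by elim: i => [|i IH]; rewrite ?lin_change1 // !exprS lin_changeM IH. Qed.
Lemma lin_change_sum s (T : Type) (r : seq T) (P : pred T) (F : T -> S) :
  lin_change s (\sum_(i <- r | P i) F i) = \sum_(i <- r | P i) lin_change s (F i).
Proof. exact: raddf_sum. Qed.

Lemma lin_changeXU s j : lin_change s 'X_j = \sum_i s i j *: 'X_i.
Proof.
rewrite /lin_change comp_mpolyXU (nth_map j) ?size_enum_ord //.
by apply: eq_bigr => i _; rewrite nth_ord_enum.
Qed.

Lemma lin_changeX s m : lin_change s 'X_[m] = \prod_i lin_change s 'X_i ^+ m i.
Proof.
rewrite mpolyXE_id (big_morph _ (lin_changeM s) (lin_change1 s)).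
by apply: eq_bigr => i _; rewrite lin_change_exp.
Qed.

Lemma lin_change_ext (F G : S -> S) :
  (forall f g, F (f + g) = F f + F g) -> (forall c f, F (c *: f) = c *: F f) ->
  (forall f g, G (f + g) = G f + G g) -> (forall c f, G (c *: f) = c *: G f) ->
  (forall m, F 'X_[m] = G 'X_[m]) -> forall f, F f = G f.
Proof.
move=> FD FZ GD GZ FG f; rewrite (mpolyE f).
have F0 : F 0 = 0 by have := FZ 0 0; rewrite !scale0r.
have G0 : G 0 = 0 by have := GZ 0 0; rewrite !scale0r.
rewrite (big_morph F FD F0) (big_morph G GD G0).
by apply: eq_bigr => m _; rewrite FZ GZ FG.
Qed.

Lemma lin_change_mul s t f : lin_change s (lin_change t f) = lin_change (s *m t) f.
Proof.
move: f; apply: (lin_change_ext (F := fun f => lin_change s (lin_change t f))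
  (G := lin_change (s *m t))) => [f g|c f|f g|c f|m].
- by rewrite !lin_changeD.
- by rewrite !lin_changeZ.
- by rewrite lin_changeD.
- by rewrite lin_changeZ.
rewrite lin_changeX [RHS]lin_changeX.
rewrite (big_morph _ (lin_changeM s) (lin_change1 s)); apply: eq_bigr => i _.
rewrite lin_change_exp; apply: (congr1 (fun w => w ^+ m i)).
rewrite !lin_changeXU lin_change_sum.
under eq_bigr => j _ do rewrite lin_changeZ lin_changeXU scaler_sumr.
rewrite exchange_big; apply: eq_bigr => l _ /=.
by rewrite mxE scaler_suml; apply: eq_bigr => j _; rewrite scalerA mulrC.
Qed.

Lemma lin_change_id f : lin_change 1%:M f = f.
Proof.
move: f; apply: (lin_change_ext (F := lin_change 1%:M) (G := id)) => [f g|c f|//|//|m].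
- by rewrite lin_changeD.
- by rewrite lin_changeZ.
rewrite lin_changeX mpolyXE_id; apply: eq_bigr => i _.
apply: (congr1 (fun w => w ^+ m i)).
rewrite lin_changeXU (bigD1 i) //= big1 ?addr0 ?mxE ?eqxx ?scale1r //.
by move=> j ji; rewrite mxE (negPf ji) scale0r.
Qed.

Lemma lin_change_homogXU s j : lin_change s 'X_j \is 1.-homog.
Proof.
by rewrite lin_changeXU; apply: rpred_sum => i _; apply: rpredZ; exact: homogXi.
Qed.

Lemma homog_prod_exp (F : 'I_n -> S) (m : 'X_{1..n}) : (forall i, F i \is 1.-homog) ->
  \prod_i F i ^+ m i \is (mdeg m).-homog.
Proof.
move=> hF; rewrite mdegE; elim/big_ind2: _ => [|d f e g hf hg|i _].
- exact: dhomog1.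
- exact: dhomogM.
- by have := dhomogMn (m i) (hF i); rewrite mul1n.
Qed.

Lemma lin_change_homog s d f : f \is d.-homog -> lin_change s f \is d.-homog.
Proof.
move=> hf; rewrite (mpolyE f) lin_change_sum big_seq; apply: rpred_sum => m ms.
rewrite lin_changeZ; apply: rpredZ; rewrite lin_changeX -(dhomog_mf hf ms).
by apply: homog_prod_exp => i; exact: lin_change_homogXU.
Qed.

Lemma lin_change_scale c s d f : f \is d.-homog ->
  lin_change (c *: s) f = c ^+ d *: lin_change s f.
Proof.
move=> hf; rewrite (mpolyE f) !lin_change_sum scaler_sumr.
apply: eq_big_seq => m ms; rewrite !lin_changeZ !lin_changeX scalerA mulrC -scalerA.
congr (_ *: _); rewrite -(dhomog_mf hf ms) /= mdegE -prodrXr -scaler_prod.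
apply: eq_bigr => i _; rewrite -exprZn; apply: (congr1 (fun w => w ^+ m i)).
rewrite !lin_changeXU scaler_sumr; apply: eq_bigr => j _.
by rewrite mxE scalerA.
Qed.

Lemma lin_change_linform s (c : 'rV[k]_n) :
  lin_change s (linform c) = linform (c *m s^T).
Proof.
rewrite /linform lin_change_sum.
under eq_bigr => j _ do rewrite lin_changeZ lin_changeXU scaler_sumr.
rewrite exchange_big; apply: eq_bigr => i _ /=.
by rewrite mxE scaler_suml; apply: eq_bigr => j _; rewrite scalerA mxE.
Qed.

(** For invertible [s], the image of [K] under the inverse of [s] ([push_image]). Written as a
    preimage it needs no existential. *)
Definition push s K g := K (lin_change s g).

Section Push.
Variables s t : 'M[k]_n.
Hypotheses (st : s *m t = 1%:M) (ts : t *m s = 1%:M).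

Lemma lin_changeK : cancel (lin_change s) (@lin_change k n t).
Proof. by move=> f; rewrite lin_change_mul ts lin_change_id. Qed.

Lemma lin_changeVK : cancel (lin_change t) (@lin_change k n s).
Proof. by move=> f; rewrite lin_change_mul st lin_change_id. Qed.

Lemma push_image K : push t K = lin_change_ideal s K.
Proof.
apply/funext => g; apply/propext; split=> [h|[f Kf ->]].
  by exists (lin_change t g); rewrite ?lin_changeVK.
by rewrite /push lin_changeK.
Qed.

Lemma push_ideal K : ideal K -> ideal (push t K).
Proof.
move=> hK; apply: idealI => [|p x hx|x y hx hy]; rewrite /push.
- by rewrite lin_change0; apply: ideal0.
- by rewrite lin_changeM; apply: ideal_mull.
- by rewrite lin_changeD; apply: idealD.
Qed.

Lemma push_strict K B : strict_incl K B -> strict_incl (push t K) (push t B).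
Proof.
move=> [sub [x [Bx Kx]]]; split=> [y|]; first exact: sub.
by exists (lin_change s x); rewrite /push lin_changeK.
Qed.

Lemma push_chain K B l N : chain K B l N ->
  chain (push t K) (push t B) l (fun i => push t (N i)).
Proof.
move=> [h1 h2 h3 h4]; split=> [i|i x|i x|i il].
- exact: push_ideal.
- exact: h2.
- exact: h3.
- exact/push_strict/h4.
Qed.

Lemma pushK K : push s (push t K) = K.
Proof. by apply/funext => f; rewrite /push lin_changeK. Qed.

Lemma push_tors K N x : tors K N (lin_change t x) -> tors (push t K) N x.
Proof.
move=> h d p Nd hp; rewrite /push lin_changeM; apply: (h d) => //.
exact: lin_change_homog.
Qed.

Lemma push_colinf K z : push t (colinf K z) = colinf (push t K) (lin_change s z).
Proof.
apply/funext => f; apply/propext.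
by split=> -[i h]; exists i; move: h; rewrite /push lin_changeM lin_change_exp lin_changeK.
Qed.

Lemma push_addz K z : push t (addz K z) = addz (push t K) (lin_change s z).
Proof.
apply/funext => f; apply/propext; split=> -[g h].
  by exists (lin_change s g); rewrite /push lin_changeB lin_changeM !lin_changeK.
exists (lin_change t g); move: h.
by rewrite /push lin_changeB lin_changeM !lin_changeK.
Qed.

End Push.

Lemma push_len s t K B l : s *m t = 1%:M -> t *m s = 1%:M ->
  idl_len K B l -> idl_len (push t K) (push t B) l.
Proof.
move=> st ts [[N hN] hl]; split; first by exists (fun i => push t (N i)); apply: (push_chain ts).
move=> e [C /(push_chain st)]; rewrite !(pushK ts) => hC.
by apply: hl; exists (fun i => push s (C i)).
Qed.

Lemma push_bval s t (z : 'I_n -> S) ps K v : s *m t = 1%:M -> t *m s = 1%:M ->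
  bval z ps K v -> bval (fun i => lin_change s (z i)) ps (push t K) v.
Proof.
move=> st ts; elim: ps K v => [|q ps IH] K v /=.
  move=> [/(push_len st ts) hl [N hN]]; split; first exact: hl.
  by exists N => x; apply: push_tors.
move=> [l [v' [-> hl [N hN] hv']]]; exists l, v'; rewrite -(push_colinf ts); split=> //.
- exact: (push_len st ts hl).
- by exists N => x hx; apply: push_tors; apply: hN.
- by move: (IH _ _ hv'); rewrite /flag_next (push_addz ts) (push_colinf ts).
Qed.

Lemma push_hid s t K : s *m t = 1%:M -> t *m s = 1%:M -> hid K -> hid (push t K).
Proof.
move=> st ts [hK dK]; split; first exact: push_ideal.
move=> d f Kf; rewrite /push.
suff -> : lin_change t (pihomog mdeg d f) = pihomog mdeg d (lin_change t f) by exact: dK.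
set fd := pihomog mdeg d f.
rewrite -{1}(subrK fd f) lin_changeD raddfD /=.
rewrite [X in _ + X]pihomog_dE ?lin_change_homog ?pihomogP //.
rewrite -[LHS]add0r; congr (_ + _); rewrite [f - fd]mpolyE lin_change_sum.
rewrite raddf_sum big1_seq //= => m; rewrite mcoeff_msupp mcoeffB mcoeff_pihomog.
have [|md] := eqVneq (mdeg m) d; first by rewrite subrr eqxx.
move=> _; apply: (@pihomog_ne0 _ _ mdeg (mdeg m)); first exact: md.
by apply/lin_change_homog/rpredZ; exact: homogX.
Qed.

End LinChange.

(** * Polynomial families and genericity *)

Section PolyFun.
Variables (k : fieldType) (n : nat).
Local Notation S := {mpoly k[n]}.

Definition polyfun (F : k -> k) := exists P : {poly k}, forall t, F t = P.[t].

Lemma polyfun_ext F G : (forall t, F t = G t) -> polyfun F -> polyfun G.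
Proof. by move=> e [P hP]; exists P => t; rewrite -e. Qed.

Lemma polyfun_const c : polyfun (fun=> c).
Proof. by exists c%:P => t; rewrite hornerC. Qed.

Lemma polyfun_id : polyfun id.
Proof. by exists 'X => t; rewrite hornerX. Qed.

Lemma polyfunD F G : polyfun F -> polyfun G -> polyfun (fun t => F t + G t).
Proof. by move=> [P hP] [Q hQ]; exists (P + Q) => t; rewrite hornerD hP hQ. Qed.

Lemma polyfunM F G : polyfun F -> polyfun G -> polyfun (fun t => F t * G t).
Proof. by move=> [P hP] [Q hQ]; exists (P * Q) => t; rewrite hornerM hP hQ. Qed.

Lemma polyfunX F i : polyfun F -> polyfun (fun t => F t ^+ i).
Proof. by move=> [P hP]; exists (P ^+ i) => t; rewrite horner_exp hP. Qed.

Lemma polyfun_sum (T : Type) (r : seq T) (P : pred T) (F : T -> k -> k) :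
  (forall i, polyfun (F i)) -> polyfun (fun t => \sum_(i <- r | P i) F i t).
Proof.
move=> h; elim: r => [|a r IH].
  by apply: polyfun_ext (polyfun_const 0) => t; rewrite big_nil.
case Pa : (P a).
  by apply: polyfun_ext (polyfunD (h a) IH) => t; rewrite big_cons Pa.
by apply: polyfun_ext IH => t; rewrite big_cons Pa.
Qed.

Lemma polyfun_prod (T : Type) (r : seq T) (P : pred T) (F : T -> k -> k) :
  (forall i, polyfun (F i)) -> polyfun (fun t => \prod_(i <- r | P i) F i t).
Proof.
move=> h; elim: r => [|a r IH].
  by apply: polyfun_ext (polyfun_const 1) => t; rewrite big_nil.
case Pa : (P a).
  by apply: polyfun_ext (polyfunM (h a) IH) => t; rewrite big_cons Pa.
by apply: polyfun_ext IH => t; rewrite big_cons Pa.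
Qed.

Lemma polyfun_cofin F t0 : polyfun F -> F t0 != 0 -> cofin (fun t => F t != 0).
Proof.
move=> [P hP] h; exists P; last by move=> t; rewrite hP.
by apply: contraNneq h => e; rewrite hP e horner0.
Qed.

Definition polymx m p (Y : k -> 'M[k]_(m, p)) := forall i j, polyfun (fun t => Y t i j).

Lemma polyfun_det m (Y : k -> 'M[k]_m) : polymx Y -> polyfun (fun t => \det (Y t)).
Proof.
move=> hY; rewrite /determinant; apply: polyfun_sum => s.
by apply: polyfunM; [exact: polyfun_const | apply: polyfun_prod].
Qed.

Lemma polymx_adj m (Y : k -> 'M[k]_m) : polymx Y -> polymx (fun t => \adj (Y t)).
Proof.
move=> hY i j; apply: (@polyfun_ext (fun t => cofactor (Y t) j i)).
  by move=> t; rewrite mxE.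
rewrite /cofactor; apply: polyfunM; first exact: polyfun_const.
apply: polyfun_det => a b; apply: polyfun_ext (hY (lift j a) (lift i b)) => t.
by rewrite !mxE.
Qed.

Lemma polymx_line m p (A B : 'M[k]_(m, p)) : polymx (fun t => A + t *: B).
Proof.
move=> i j; apply: (@polyfun_ext (fun t => A i j + t * B i j)).
  by move=> t; rewrite !mxE.
apply: polyfunD; first exact: polyfun_const.
by apply: polyfunM; [exact: polyfun_id | exact: polyfun_const].
Qed.

Lemma polyfun_meval m (f : {mpoly k[m]}) (c : k -> 'rV[k]_m) :
  polymx c -> polyfun (fun t => f.@[c t 0]).
Proof.
move=> hc; apply: (@polyfun_ext (fun t => \sum_(u <- msupp f) f@_u * \prod_i c t 0 i ^+ u i)).
  by move=> t; rewrite mevalE.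
apply: polyfun_sum => u; apply: polyfunM; first exact: polyfun_const.
by apply: polyfun_prod => i; apply: polyfunX.
Qed.

Lemma zariski_cofin m (W : 'rV[k]_m -> Prop) (c : k -> 'rV[k]_m) t0 :
  zariski_open W -> polymx c -> W (c t0) -> cofin (fun t => W (c t)).
Proof.
move=> [F hF] hc /hF[f Ff fc]; apply: cofin_mono (polyfun_cofin (polyfun_meval f hc) fc).
by move=> t h; apply/hF; exists f.
Qed.

Definition polyfam (F : k -> S) := forall m, polyfun (fun t => (F t)@_m).

Lemma polyfam_const f : polyfam (fun=> f).
Proof. by move=> m; exact: polyfun_const. Qed.

Lemma polyfam_ext F G : (forall t, F t = G t) -> polyfam F -> polyfam G.
Proof. by move=> e hF m; apply: polyfun_ext (hF m) => t; rewrite e. Qed.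

Lemma polyfamZ c F : polyfun c -> polyfam F -> polyfam (fun t => c t *: F t).
Proof.
move=> hc hF m; apply: polyfun_ext (polyfunM hc (hF m)) => t.
by rewrite mcoeffZ.
Qed.

Lemma polyfamM F G : polyfam F -> polyfam G -> polyfam (fun t => F t * G t).
Proof.
move=> hF hG m; apply: polyfun_ext; first by move=> t; rewrite mcoeffM.
by apply: polyfun_sum => i; apply: polyfunM.
Qed.

Lemma polyfam_sum (T : Type) (r : seq T) (P : pred T) (F : T -> k -> S) :
  (forall i, polyfam (F i)) -> polyfam (fun t => \sum_(i <- r | P i) F i t).
Proof.
move=> h m; apply: (@polyfun_ext (fun t => \sum_(i <- r | P i) (F i t)@_m)).
  by move=> t; rewrite raddf_sum.
by apply: polyfun_sum => i; apply: h.
Qed.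

Lemma polyfam_exp F i : polyfam F -> polyfam (fun t => F t ^+ i).
Proof.
move=> hF; elim: i => [|i IH]; first exact: polyfam_const.
by apply: polyfam_ext (polyfamM hF IH) => t; rewrite exprS.
Qed.

Lemma polyfam_prod (T : Type) (r : seq T) (F : T -> k -> S) :
  (forall i, polyfam (F i)) -> polyfam (fun t => \prod_(i <- r) F i t).
Proof.
move=> h; elim: r => [|a r IH].
  by apply: polyfam_ext (polyfam_const 1) => t; rewrite big_nil.
by apply: polyfam_ext (polyfamM (h a) IH) => t; rewrite big_cons.
Qed.

Lemma polyfam_lin_change (s : k -> 'M[k]_n) f : polymx s ->
  polyfam (fun t => lin_change (s t) f).
Proof.
move=> hs; apply: (@polyfam_ext (fun t => \sum_(m <- msupp f)
    f@_m *: \prod_i (\sum_j s t j i *: 'X_j) ^+ m i)).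
  move=> t; rewrite [in RHS](mpolyE f) lin_change_sum; apply: eq_bigr => m _.
  rewrite lin_changeZ lin_changeX; congr (_ *: _); apply: eq_bigr => i _.
  by rewrite lin_changeXU.
apply: polyfam_sum => m; apply: polyfamZ; first exact: polyfun_const.
apply: polyfam_prod => i; apply: polyfam_exp; apply: polyfam_sum => j.
by apply: polyfamZ; [exact: hs | exact: polyfam_const].
Qed.

End PolyFun.

Section Spread.
Variables (k : fieldType) (n : nat).
Local Notation S := {mpoly k[n]}.
Implicit Types (f g h : S) (m u : 'X_{1..n}) (V K : S -> Prop) (E T : seq 'X_{1..n}).

(** The projection of [V] to the span of the monomials in [T] is onto. As a nonvanishing minor, the
    condition persists for almost all values of a parameter. *)
Definition spread V T := exists f : 'I_(size T) -> S, (forall i, V (f i)) /\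
  \det (\matrix_(i, j) (f i)@_(nth 0%MM T j)) != 0.

Lemma spread_interp V T (a : 'X_{1..n} -> k) : subspace V -> spread V T ->
  exists2 f, V f & forall u, u \in T -> f@_u = a u.
Proof.
move=> hV [f [Vf]]; set A := (X in \det X) => dA.
have uA : A \in unitmx by rewrite unitmxE unitfE.
have hA i j : A i j = (f i)@_(nth 0%MM T j) by rewrite mxE.
have [c hc] : exists c, c *m A = \row_j a (nth 0%MM T j).
  by exists ((\row_j a (nth 0%MM T j)) *m invmx A); rewrite mulmxKV.
exists (\sum_i c 0 i *: f i); first by apply: subspace_sum => // i _; apply: subspaceZ.
move=> u uT; have iu : (index u T < size T)%N by rewrite index_mem.
move/(congr1 (fun M : 'rV_(size T) => M 0 (Ordinal iu))): hc.
rewrite [RHS]mxE /= nth_index // => <-; rewrite mxE raddf_sum.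
by apply: eq_bigr => i _; rewrite /= mcoeffZ hA /= nth_index.
Qed.

(** The coefficient matrix is triangular up to ordering: in a kernel vector, the greatest leading
    monomial of nonzero weight cannot be cancelled. *)
Lemma lead_spread V E : uniq E -> (forall u, u \in E -> lmset V u) -> spread V E.
Proof.
move=> uE hE.
have /choice[f hf] (i : 'I_(size E)) : exists f, V f /\ lead f (nth 0%MM E i).
  by have [f Vf lf] := hE _ (mem_nth 0%MM (ltn_ord i)); exists f.
exists f; split=> [i|]; first by have [] := hf i.
apply/negP => /det0P[v v0 vA].
have [|m ms hm] := @rlex_max n [seq nth 0%MM E (i : 'I_(size E)) | i <- enum 'I_(size E) & v 0 i != 0].
  have [i vi] : exists i, v 0 i != 0.
    apply/existsP; apply: contraNT v0; rewrite negb_exists => /forallP h.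
    by apply/eqP/rowP => i; rewrite mxE; have := h i; rewrite negbK => /eqP.
  have : i \in [seq i <- enum 'I_(size E) | v 0 i != 0] by rewrite mem_filter vi mem_enum.
  by case: [seq i <- _ | _].
case/mapP: ms => i; rewrite mem_filter => /andP[vi _] em.
have := congr1 (fun M : 'rV_(size E) => M 0 i) vA; rewrite !mxE (bigD1 i) //= big1.
  move/eqP; rewrite addr0 mulf_eq0 (negPf vi) mxE /= => /eqP e.
  by have := (hf i).2.1; rewrite e eqxx.
move=> j ji; rewrite mxE; have [->|vj] := eqVneq (v 0 j) 0; first by rewrite mul0r.
have ne : nth 0%MM E j != m by rewrite em nth_uniq.
rewrite -em (hf j).2.2 ?mulr0 //; case/orP: (rlex_total ne) => // gt.
suff : rlex_gt (nth 0%MM E j) m = false by rewrite gt.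
by apply: hm; apply: map_f; rewrite mem_filter vj mem_enum.
Qed.

Definition rlex_up (Q : pred 'X_{1..n}) := forall m u, Q m -> rlex_gt u m -> Q u.

(** On [Q], every element of [V] agrees with a combination of elements with leading monomials in
    both [E] and [Q]: once a leading monomial leaves [Q], no term in [Q] remains. So projecting [V]
    to the part of [T] in [Q] has rank at most [count Q E], while spreading makes it onto. *)
Lemma spread_count V E T (Q : pred 'X_{1..n}) : subspace V -> uniq T ->
  spread V T -> enumerates E (lmset V) -> rlex_up Q -> (count Q T <= count Q E)%N.
Proof.
move=> hV uT hT [uE hE] hQ; rewrite -!size_filter.
set T' := filter Q T; set E' := filter Q E.
have /choice[h hh] (i : 'I_(size E')) : exists f, V f /\ lead f (nth 0%MM E' i).
  have := mem_nth 0%MM (ltn_ord i); rewrite mem_filter => /andP[_ /hE[f]].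
  by exists f.
have red0 f : (forall u, Q u -> f@_u = 0) -> exists c : 'rV[k]_(size E'),
    forall u, Q u -> f@_u = (\sum_i c 0 i *: h i)@_u.
  move=> f0; exists 0 => u /f0 ->; rewrite big1 ?mcoeff0 // => i _.
  by rewrite mxE scale0r.
have red f : V f -> exists c : 'rV[k]_(size E'),
    forall u, Q u -> f@_u = (\sum_i c 0 i *: h i)@_u.
  move=> Vf; have [e|/lead_exists[m lm]] := eqVneq f 0.
    by apply: red0 => u _; rewrite e mcoeff0.
  elim/rlex_ind: m f Vf lm => m IH f Vf lm.
  have [Qm|nQm] := boolP (Q m); last first.
    apply: red0 => u Qu; apply/eqP; apply: contraT => fu.
    have [eu|um] := eqVneq u m; first by rewrite -eu Qu in nQm.
    by rewrite (hQ u m Qu (lead_le lm fu um)) in nQm.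
  have mE : m \in E' by rewrite mem_filter Qm; apply/hE; exists f.
  have im : (index m E' < size E')%N by rewrite index_mem.
  pose i := Ordinal im; have [Vh lh] := hh i; rewrite /= nth_index // in lh.
  pose a := f@_m / (h i)@_m.
  have := lead_cancel lm lh; rewrite /= -/a => hc.
  have Vf' : V (f - a *: h i) by apply: subspaceB => //; apply: subspaceZ.
  have [c hcc] : exists c : 'rV[k]_(size E'),
      forall u, Q u -> (f - a *: h i)@_u = (\sum_i c 0 i *: h i)@_u.
    case: hc => [e|[u lu mu]]; last exact: IH mu _ Vf' lu.
    by apply: red0 => u _; rewrite e mcoeff0.
  exists (c + a *: delta_mx 0 i) => u Qu.
  rewrite -(subrK (a *: h i) f) mcoeffD hcc // -mcoeffD; congr (_@__).
  transitivity (\sum_j c 0 j *: h j + \sum_j (a *: delta_mx (0 : 'I_1) i) 0 j *: h j).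
    congr (_ + _); rewrite (bigD1 i) //= big1 ?addr0; first by rewrite !mxE !eqxx mulr1.
    by move=> j ji; rewrite !mxE (negPf ji) andbF mulr0 scale0r.
  by rewrite -big_split; apply: eq_bigr => j _; rewrite /= [in RHS]mxE scalerDl.
pose H : 'M[k]_(size E', size T') := \matrix_(i, j) (h i)@_(nth 0%MM T' j).
suff : (1%:M <= H)%MS.
  by move/mxrankS; rewrite mxrank1 => /leq_trans; apply; exact: rank_leq_row.
apply/row_subP => j; set b := row j 1%:M.
have [f Vf hf] := spread_interp (fun u => (u == nth 0%MM T' j)%:R) hV hT.
have [c hc] := red f Vf; apply/submxP; exists c; apply/rowP => l.
have : nth 0%MM T' l \in T' by apply: mem_nth.
rewrite mem_filter => /andP[Ql Tl].
rewrite !mxE; have := hc _ Ql; rewrite hf // nth_uniq ?filter_uniq //.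
rewrite raddf_sum /= eq_sym => e; apply: etrans (etrans e _); last first.
  by apply: eq_bigr => i _; rewrite mcoeffZ mxE.
by [].
Qed.

Lemma count_rlex_mem T m : uniq T ->
  count (fun u => (u == m) || rlex_gt u m) T =
  ((m \in T) + count (fun u => rlex_gt u m) T)%N.
Proof.
move=> uT; rewrite -count_uniq_mem // -count_predUI.
rewrite [X in (_ = _ + X)%N](@eq_count _ _ pred0) ?count_pred0 ?addn0 //.
by move=> u /=; case: eqP => // ->; rewrite rlex_irr.
Qed.

(** The monomials at least [m] and those greater than [m] form up-sets that differ by [m] alone. *)
Lemma count_mem_eq E T : uniq E -> uniq T ->
  (forall Q, rlex_up Q -> count Q T = count Q E) -> E =i T.
Proof.
move=> uE uT h m.
have h1 : rlex_up (fun u => rlex_gt u m) by move=> a b am ba; apply: rlex_trans ba am.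
have h2 : rlex_up (fun u => (u == m) || rlex_gt u m).
  by move=> a b /= /orP[/eqP->->|/(rlex_trans _) am /am->]; rewrite ?orbT.
have := h _ h2; rewrite !count_rlex_mem // (h _ h1) => /addIn.
by do 2 case: (m \in _).
Qed.

(** Spreading for the degree [d] part of the image of [K] under [s], with witnesses taken in [K]
    itself; for fixed witnesses the minor is polynomial in [s]. *)
Definition spreadS (s : 'M[k]_n) K d T := exists f : 'I_(size T) -> S,
  (forall i, Vd K d (f i)) /\
  \det (\matrix_(i, j) (lin_change s (f i))@_(nth 0%MM T j)) != 0.

Lemma spreadS_spread s K d T : spreadS s K d T -> spread (Vd (lin_change_ideal s K) d) T.
Proof.
move=> [f [hf df]]; exists (fun i => lin_change s (f i)); split=> // i.
have [Kf hd] := hf i; split; last exact: lin_change_homog.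
by exists (f i).
Qed.

Lemma spread_spreadS s K d T : s \in unitmx ->
  spread (Vd (lin_change_ideal s K) d) T -> spreadS s K d T.
Proof.
move=> us [f [hf df]].
have /choice[g hg] i : exists g, Vd K d g /\ f i = lin_change s g.
  have [[g Kg e] hd] := hf i; exists g; split=> //; split=> //.
  rewrite -(lin_changeK (mulVmx us) g) -e; exact: lin_change_homog.
exists g; split=> [i|]; first by have [] := hg i.
rewrite (_ : (\matrix_(i, j) _) = \matrix_(i, j) (f i)@_(nth 0%MM T j)) //.
by apply/matrixP => i j; rewrite !mxE; have [_ ->] := hg i.
Qed.

Lemma spreadS_cofin (s : k -> 'M[k]_n) K d T t0 : polymx s ->
  spreadS (s t0) K d T -> cofin (fun t => spreadS (s t) K d T).
Proof.
move=> hs [f [hf df]].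
have pf : polyfun (fun t => \det (\matrix_(i, j) (lin_change (s t) (f i))@_(nth 0%MM T j))).
  apply: polyfun_det => i j; apply: polyfun_ext (polyfam_lin_change (f i) hs _).
  by move=> t; rewrite mxE.
by apply: cofin_mono (polyfun_cofin pf df) => t h; exists f.
Qed.

Lemma spreadS_scale (c : k) s K d T : c != 0 -> spreadS (c *: s) K d T -> spreadS s K d T.
Proof.
move=> c0 [f [hf df]]; exists f; split; first exact: hf.
apply: contraNneq df => e.
rewrite (_ : (\matrix_(i, j) _) = c ^+ d *: \matrix_(i, j) (lin_change s (f i))@_(nth 0%MM T j)).
  by rewrite detZ e mulr0.
by apply/matrixP => i j; rewrite !mxE (lin_change_scale _ _ (hf i).2) mcoeffZ.
Qed.

End Spread.

(** * Degeneration to the initial ideal *)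

Section Degeneration.
Variables (k : fieldType) (n : nat).
Hypothesis hk : [pchar k] =i pred0.
Local Notation S := {mpoly k[n]}.
Implicit Types (f g h : S) (m u : 'X_{1..n}) (V K I J : S -> Prop) (T : seq 'X_{1..n}).

(** The monomial with exponent [u] gets weight [wt B u]. In a form of degree below [B] the leading
    monomial alone has the least weight, so it is what survives at [t = 0] after rescaling. *)
Definition torus (B : nat) (t : k) : 'M[k]_n := diag_mx (\row_i t ^+ (B ^ i)).

Lemma lin_change_torus B t u : lin_change (torus B t) 'X_[u] = t ^+ wt B u *: 'X_[u] :> S.
Proof.
rewrite lin_changeX [in RHS]mpolyXE_id -prodrXr -scaler_prod.
apply: eq_bigr => i _; rewrite mulnC exprM -exprZn; apply: (congr1 (fun w => w ^+ u i)).
rewrite lin_changeXU (bigD1 i) //= big1 ?addr0 => [|j ji].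
  by rewrite mxE eqxx mxE mulr1n.
by rewrite mxE (negPf ji) mulr0n scale0r.
Qed.

Lemma torus_unit B t : t != 0 -> torus B t \in unitmx.
Proof.
move=> t0; rewrite unitmxE unitfE det_diag; apply/prodf_neq0 => i _.
by rewrite mxE expf_neq0.
Qed.

(** The torus orbit of [h], rescaled so as to extend over [t = 0], where its
    value is the leading monomial [e]. *)
Definition flow B e h (t : k) : S :=
  (h@_e)^-1 *: \sum_(u <- msupp h) (h@_u * t ^+ (wt B u - wt B e)) *: 'X_[u].

Lemma wt_lead B d h e u : (d < B)%N -> h \is d.-homog -> lead h e -> u \in msupp h ->
  u != e -> (wt B e < wt B u)%N.
Proof.
move=> dB hd le; rewrite mcoeff_msupp => hu ue.
apply: rlex_gt_wt; last exact: lead_le hu ue.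
  by rewrite (homog_mcoeff hd le.1) (homog_mcoeff hd hu).
by rewrite (homog_mcoeff hd le.1).
Qed.

Lemma flow0 B d h e : (d < B)%N -> h \is d.-homog -> lead h e ->
  flow B e h 0 = 'X_[e].
Proof.
move=> dB hd le; have es : e \in msupp h by rewrite mcoeff_msupp le.1.
rewrite /flow (bigD1_seq e) ?msupp_uniq //= big_seq_cond big1 ?addr0.
  by rewrite subnn expr0 mulr1 scalerA mulVf ?scale1r // le.1.
move=> u /andP[us ue]; have := wt_lead dB hd le us ue.
by rewrite -subn_gt0 => /prednK <-; rewrite expr0n /= mulr0 scale0r.
Qed.

Lemma flow_torus B d h e t : (d < B)%N -> h \is d.-homog -> lead h e -> t != 0 ->
  flow B e h t = ((h@_e)^-1 * t ^- wt B e) *: lin_change (torus B t) h.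
Proof.
move=> dB hd le t0; rewrite /flow -scalerA; congr (_ *: _).
rewrite {3}(mpolyE h) lin_change_sum scaler_sumr; apply: eq_big_seq => u us.
rewrite lin_changeZ lin_change_torus !scalerA; congr (_ *: _).
have wle : (wt B e <= wt B u)%N.
  by have [->//|ue] := eqVneq u e; apply/ltnW/(wt_lead dB hd).
by rewrite -[in RHS](subnKC wle) exprD [t ^- _ * _]mulrC -mulrA mulKf ?expf_neq0.
Qed.

Lemma flow_polyfam (s : 'M[k]_n) B e h : polyfam (fun t => lin_change s (flow B e h t)).
Proof.
apply: (@polyfam_ext _ _ (fun t => (h@_e)^-1 *: \sum_(u <- msupp h)
    (h@_u * t ^+ (wt B u - wt B e)) *: lin_change s 'X_[u])).
  move=> t; rewrite lin_changeZ lin_change_sum; congr (_ *: _).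
  by apply: eq_bigr => u _; rewrite lin_changeZ.
apply: polyfamZ; first exact: polyfun_const.
apply: polyfam_sum => u; apply: polyfamZ; last exact: polyfam_const.
apply: polyfunM; first exact: polyfun_const.
by apply: polyfunX; exact: polyfun_id.
Qed.

(** Replace each monomial [e] of [f i] by the [flow] of an element of the image of [I] with leading
    monomial [e]. The minor becomes a polynomial in [t] with the given nonzero value at [t = 0], so
    it is nonzero at some other [t], where the family lies in a translate of [I]. *)
Lemma spreadS_degenerate I J (s g : 'M[k]_n) d T : s \in unitmx -> g \in unitmx ->
  hid I -> (forall f, J f -> forall m, f@_m != 0 -> lmset (lin_change_ideal s I) m) ->
  spreadS g J d T -> exists2 s', s' \in unitmx & spreadS s' I d T.
Proof.
move=> us ug hI hJ [f [hf df]]; pose B := d.+1.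
have hsI : hid (lin_change_ideal s I).
  rewrite -(push_image (mulmxV us) (mulVmx us)).
  exact: push_hid (mulmxV us) (mulVmx us) hI.
have /choice[y hy] m : exists y, lmset (lin_change_ideal s I) m ->
    [/\ I y, y \is (mdeg m).-homog & lead (lin_change s y) m].
  have [hm|] := EM (lmset (lin_change_ideal s I) m); last by exists 0.
  have [_ [[y Iy ->] hd ly]] := lmset_homog hsI hm; exists y => _; split=> //.
  by rewrite -(lin_changeK (mulVmx us) y); apply: lin_change_homog.
have hfy i e : e \in msupp (f i) ->
    [/\ I (y e), y e \is d.-homog & lead (lin_change s (y e)) e].
  rewrite mcoeff_msupp => fe; have [Jf hd] := hf i.
  by have [] := hy e (hJ _ Jf _ fe); rewrite (homog_mcoeff hd fe).
pose h e := lin_change s (y e).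
pose F i t := \sum_(e <- msupp (f i)) (f i)@_e *: flow B e (h e) t.
have F0 i : F i 0 = f i.
  rewrite [RHS]mpolyE; apply: eq_big_seq => e es; have [_ hd le] := hfy i e es.
  by rewrite (@flow0 B d) // lin_change_homog.
have pF i : polyfam (fun t => lin_change g (F i t)).
  apply: (@polyfam_ext _ _ (fun t => \sum_(e <- msupp (f i))
      (f i)@_e *: lin_change g (flow B e (h e) t))).
    move=> t; rewrite [in RHS]/F lin_change_sum; apply: eq_bigr => e _.
    by rewrite [in RHS]lin_changeZ.
  apply: polyfam_sum => e; apply: polyfamZ; first exact: polyfun_const.
  exact: flow_polyfam.
have pdet : polyfun (fun t =>
    \det (\matrix_(i, j) (lin_change g (F i t))@_(nth 0%MM T j))).
  apply: polyfun_det => i j.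
  apply: polyfun_ext (pF i (nth 0%MM T j)).
  by move=> t; rewrite mxE.
have d0 : \det (\matrix_(i, j) (lin_change g (F i 0))@_(nth 0%MM T j)) != 0.
  rewrite [X in \det X](_ : _ = \matrix_(i, j) (lin_change g (f i))@_(nth 0%MM T j)).
    exact: df.
  by apply/matrixP => i j; rewrite !mxE F0.
have [t [dt t0]] := cofin_exists hk (cofin_and (polyfun_cofin pdet d0) (cofin_neq 0)).
pose c i e := (f i)@_e * (((h e)@_e)^-1 * t ^- wt B e).
pose z i := \sum_(e <- msupp (f i)) c i e *: y e.
have eF i : lin_change (torus B t) (lin_change s (z i)) = F i t.
  rewrite /z /F (lin_change_sum s) (lin_change_sum (torus B t)); apply: eq_big_seq => e es.
  have [_ hd le] := hfy i e es.
  by rewrite (@flow_torus B d) ?lin_change_homog // !lin_changeZ scalerA.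
exists (g *m torus B t *m s); first by rewrite !unitmx_mul ug us torus_unit.
exists z; split=> [i|].
  apply: subspace_sum_seq => [|e es]; first exact: Vd_subspace hI.1.
  apply: subspaceZ; first exact: Vd_subspace hI.1.
  by have [Iy hd _] := hfy i e es.
rewrite [X in \det X](_ : _ = \matrix_(i, j) (lin_change g (F i t))@_(nth 0%MM T j)).
  exact: dt.
by apply/matrixP => i j; rewrite !mxE -!lin_change_mul eF.
Qed.

End Degeneration.

(** * Generic coordinates *)

Section Generic.
Variables (k : fieldType) (n : nat).
Hypothesis hk : [pchar k] =i pred0.
Local Notation S := {mpoly k[n]}.
Implicit Types (f g h : S) (m u : 'X_{1..n}) (V K I J : S -> Prop) (T : seq 'X_{1..n}).
Implicit Types (E : 'X_{1..n} -> Prop) (s : 'M[k]_n).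

Lemma img_hid s K : s \in unitmx -> hid K -> hid (lin_change_ideal s K).
Proof.
move=> us hK; rewrite -(push_image (mulmxV us) (mulVmx us)).
exact: push_hid (mulmxV us) (mulVmx us) hK.
Qed.

Definition edeg E d m := E m /\ mdeg m = d.

Lemma edeg_list E d : exists T, enumerates T (edeg E d).
Proof. by apply: (@bounded_enumerates _ d.+1) => m [_ ->]. Qed.

Lemma lmset_Vd K d m : hid K -> lmset (Vd K d) m <-> edeg (lmset K) d m.
Proof.
move=> hK; split=> [[f [Kf hd] lf]|[hm <-]].
  by split; [exists f | exact: homog_mcoeff hd lf.1].
by have [f [Kf hd lf]] := lmset_homog hK hm; exists f.
Qed.

(** In each degree no coordinate change of [K] spreads over more monomials of an up-set than [E] has
    there: [E] bounds all initial ideals of coordinate changes. *)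
Definition dominated K E := forall s d T T' (Q : pred 'X_{1..n}), s \in unitmx ->
  uniq T -> spreadS s K d T -> enumerates T' (edeg E d) -> rlex_up Q ->
  (count Q T <= count Q T')%N.

Lemma count_spreadS s K d T T' (Q : pred 'X_{1..n}) : s \in unitmx -> hid K -> uniq T ->
  spreadS s K d T -> enumerates T' (edeg (lmset (lin_change_ideal s K)) d) ->
  rlex_up Q -> (count Q T <= count Q T')%N.
Proof.
move=> us hK uT hT [uT' hT'] hQ; have hs := img_hid us hK.
apply: (spread_count (Vd_subspace d hs.1) uT (spreadS_spread hT)) => //.
split=> // m; split; first by move/hT'/(lmset_Vd d m hs).
by move/(lmset_Vd d m hs)/hT'.
Qed.

Lemma lmset_spreadS s K d T : s \in unitmx -> hid K ->
  enumerates T (edeg (lmset (lin_change_ideal s K)) d) -> spreadS s K d T.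
Proof.
move=> us hK [uT hT]; have hs := img_hid us hK.
apply: spread_spreadS => //; apply: lead_spread => // u /hT h.
exact/lmset_Vd.
Qed.

Lemma polymx_mxvec a b (Y : k -> 'M[k]_(a, b)) : polymx Y -> polymx (fun t => mxvec (Y t)).
Proof.
move=> hY i j; rewrite ord1; case/mxvec_indexP: j => i' j'.
by apply: polyfun_ext (hY i' j') => t; rewrite mxvecE.
Qed.

Lemma unitmx_cofin a (Y : k -> 'M[k]_a) t0 : polymx Y -> Y t0 \in unitmx ->
  cofin (fun t => Y t \in unitmx).
Proof.
move=> hY; rewrite unitmxE unitfE => h.
apply: cofin_mono (polyfun_cofin (polyfun_det hY) h) => t.
by rewrite unitmxE unitfE.
Qed.

(** Join an arbitrary [s] to [s0] by a line. Almost every point is invertible, lies in [W] and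
    inherits the spreading found at [s]; there the initial ideal is [E] and [spread_count]
    applies. *)
Lemma dominated_open I E (W : 'rV[k]_(n * n) -> Prop) s0 : hid I -> zariski_open W ->
  s0 \in unitmx -> W (mxvec s0) ->
  (forall s, s \in unitmx -> W (mxvec s) ->
     forall m, lmset (lin_change_ideal s I) m <-> E m) ->
  dominated I E.
Proof.
move=> hI oW us0 Ws0 hE s d T T' Q us uT hT hT' hQ.
pose Y t := s + t *: (s0 - s); have pY : polymx Y by exact: polymx_line.
have Y0 : Y 0 = s by rewrite /Y scale0r addr0.
have Y1 : Y 1 = s0 by rewrite /Y scale1r subrKC.
have c1 : cofin (fun t => Y t \in unitmx).
  by apply: (@unitmx_cofin _ _ 0); rewrite ?Y0.
have c2 : cofin (fun t => W (mxvec (Y t))).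
  by apply: (@zariski_cofin _ _ _ _ 1 oW (polymx_mxvec pY)); rewrite Y1.
have c3 : cofin (fun t => spreadS (Y t) I d T).
  by apply: (@spreadS_cofin _ _ _ _ _ _ 0 pY); rewrite Y0.
have [t [[ut Wt] St]] := cofin_exists hk (cofin_and (cofin_and c1 c2) c3).
apply: (count_spreadS ut hI uT St) => //; split=> [|m]; first exact: hT'.1.
by rewrite hT'.2; split=> -[h1 h2]; split=> //; apply/(hE _ ut Wt m).
Qed.

(** Whatever a coordinate change of [J] spreads over, some change of [I] does too. With [J] the
    generic initial ideal this is the substantial half of its idempotence. *)
Lemma dominated_initial I J E s : s \in unitmx -> hid I ->
  (forall f, J f -> forall m, f@_m != 0 -> lmset (lin_change_ideal s I) m) ->
  dominated I E -> dominated J E.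
Proof.
move=> us hI hJ dI g d T T' Q ug uT hT hT' hQ.
have [s' us' hs'] := spreadS_degenerate hk us ug hI hJ hT.
exact: dI us' uT hs' hT' hQ.
Qed.

(** Conditions in degrees up to [D] suffice, which keeps them finite in number and hence open. There
    the two counting inequalities give equality; the generators then force [E] into the initial
    ideal in all degrees, and the bound on sizes excludes anything more. *)
Lemma lmset_generic K E D (Ed : nat -> seq 'X_{1..n}) s :
  hid K -> s \in unitmx -> dominated K E -> (forall d, enumerates (Ed d) (edeg E d)) ->
  (forall m, E m -> exists u, [/\ E u, (u <= m)%MM & (mdeg u <= D)%N]) ->
  (forall d, (d <= D)%N -> spreadS s K d (Ed d)) ->
  forall m, lmset (lin_change_ideal s K) m <-> E m.
Proof.
move=> hK us dom hEd gen hs; set L := lmset _.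
have hid_s := img_hid us hK.
have le d T (Q : pred 'X_{1..n}) : enumerates T (edeg L d) -> rlex_up Q ->
    (count Q T <= count Q (Ed d))%N.
  move=> hT hQ; have hST := lmset_spreadS us hK hT.
  exact: dom us hT.1 hST (hEd d) hQ.
have low u : (mdeg u <= D)%N -> E u -> L u.
  move=> uD Eu; have [T hT] := edeg_list L (mdeg u).
  have e : Ed (mdeg u) =i T.
    apply: count_mem_eq => [||Q hQ]; [exact: (hEd _).1 | exact: hT.1 |].
    apply/eqP; rewrite eqn_leq le //=.
    exact: count_spreadS us hK (hEd _).1 (hs _ uD) hT hQ.
  have : u \in Ed (mdeg u) by apply/(hEd _).2.
  by rewrite e => /hT.2[].
have sub m : E m -> L m.
  move=> /gen[u [Eu um uD]]; rewrite -(submK um).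
  by apply: (lmset_ideal_up hid_s.1); apply: low.
move=> m; split; last exact: sub.
move=> Lm; have [T hT] := edeg_list L (mdeg m).
have sTE : (size T <= size (Ed (mdeg m)))%N.
  by have := le _ T predT hT (fun _ _ _ _ => isT); rewrite !count_predT.
have subET : {subset Ed (mdeg m) <= T}.
  by move=> u /(hEd _).2[Eu du]; apply/hT.2; split=> //; apply: sub.
have [_ e] := uniq_min_size (hEd (mdeg m)).1 subET sTE.
have : m \in T by apply/hT.2.
by rewrite -e => /(hEd _).2[].
Qed.

Definition copen (A : 'M[k]_n -> Prop) := forall Y t0, polymx Y -> A (Y t0) ->
  cofin (fun t => A (Y t)).

(** [Y] lists the coordinates of new variables in its rows; the matrix
    [(Y^-1)^T] then carries these linear forms to the variables. *)
Lemma generic_exists K E s0 : hid K -> dominated K E -> s0 \in unitmx ->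
  (forall m, lmset (lin_change_ideal s0 K) m <-> E m) ->
  exists A : 'M[k]_n -> Prop, [/\ copen A, exists Y, A Y &
    forall Y, A Y -> Y \in unitmx /\
      forall m, lmset (lin_change_ideal (invmx Y)^T K) m <-> E m].
Proof.
move=> hK dom us0 hE.
have [G [GE hG]] := dickson E; pose D := (\max_(u <- G) mdeg u)%N.
have [Ed hEd] := choice (edeg_list E).
(* The adjugate replaces the inverse because it is polynomial in [Y]; the factor [\det Y] between
   them is absorbed by [spreadS_scale]. *)
exists (fun Y => Y \in unitmx /\
  forall d, d \in iota 0 D.+1 -> spreadS (\adj Y)^T K d (Ed d)); split.
- move=> Y t0 pY [uY sY]; apply: cofin_and; first exact: unitmx_cofin uY.
  apply: cofin_forall => d dD; apply: spreadS_cofin (sY d dD).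
  move=> i j; apply: polyfun_ext (polymx_adj pY j i) => t.
  by rewrite [RHS]mxE.
(* Chosen so that its inverse transpose is [s0]. *)
- exists (invmx s0^T); have uY : invmx s0^T \in unitmx by rewrite unitmx_inv unitmx_tr.
  split=> // d _; pose c := \det (invmx s0^T).
  have c0 : c != 0 by rewrite /c -unitfE -unitmxE.
  have e : (\adj (invmx s0^T))^T = c *: s0.
    have : invmx (invmx s0^T) = s0^T by rewrite invmxK.
    rewrite {1}/invmx uY => /(congr1 (fun M => c *: M^T)).
    by rewrite trmxK linearZ /= scalerA mulfV // scale1r.
  apply: (@spreadS_scale _ _ c^-1); first by rewrite invr_eq0.
  rewrite e scalerA mulVf // scale1r; apply: lmset_spreadS => //.
  split=> [|m]; first exact: (hEd d).1.
  by rewrite (hEd d).2; split=> -[h1 h2]; split=> //; apply/hE.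
- move=> Y [uY sY]; split=> //.
  have uI : (invmx Y)^T \in unitmx by rewrite unitmx_tr unitmx_inv.
  apply: (lmset_generic (D := D) hK uI dom hEd) => [m /hG[u uG um]|d dD].
    by exists u; split=> //; [exact: GE | exact: leq_bigmax_seq].
  have := sY d; rewrite mem_iota /= add0n ltnS => /(_ dD).
  move=> hs.
  have d0 : \det Y != 0 by rewrite -unitfE -unitmxE.
  apply: (@spreadS_scale _ _ (\det Y)); first exact: d0.
  suff -> : \det Y *: (invmx Y)^T = (\adj Y)^T by exact: hs.
  by rewrite /invmx uY linearZ /= scalerA mulfV // scale1r.
Qed.

End Generic.

(** * Cyclic modules *)

Section Cyclic.
Variables (k : fieldType) (n : nat).
Local Notation S := {mpoly k[n]}.
Implicit Types (M : gmod k n) (f g p : S) (K B : S -> Prop).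

(** A generator and its annihilator let iterated quotients be treated as [S / K] without building
    isomorphisms. *)
Definition cyclic_pres M (e : M) K := (forall x : M, exists p : S, x = p *: e) /\
  forall p : S, p *: e = 0 <-> K p.

Lemma mnm_vars (u : 'X_{1..n}) : exists2 l : seq 'I_n,
  size l = mdeg u & 'X_[u] = \prod_(i <- l) 'X_i :> S.
Proof.
have [d] := ubnP (mdeg u); elim: d u => // d IH u; rewrite ltnS => ud.
have [u0|u0] := posnP (mdeg u).
  exists [::] => //; move/eqP: u0; rewrite mdeg_eq0 => /eqP ->.
  by rewrite big_nil mpolyX0.
have [i [v e]] := mnm_pos_split u0.
have [|l sl el] := IH v; first by move: ud; rewrite e mdegD mdeg1.
by exists (i :: l); rewrite ?big_cons e ?mdegD ?mdeg1 /= ?sl // mpolyXD el.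
Qed.

Lemma homog_vars (l : seq 'I_n) : (\prod_(i <- l) 'X_i : S) \is (size l).-homog.
Proof.
elim: l => [|i l IH]; first by rewrite big_nil; apply: dhomog1.
by rewrite big_cons -[size _]/(1 + size l)%N; apply: dhomogM => //; exact: homogXi.
Qed.

Lemma annz_ideal M (z : M) : ideal (fun p : S => p *: z = 0).
Proof.
apply: idealI => [|p x hx|x y hx hy]; first by rewrite scale0r.
  by rewrite -scalerA hx scaler0.
by rewrite scalerDl hx hy addr0.
Qed.

Lemma gamma_memP M (z : M) : gamma_mem z <->
  exists t, forall d (p : S), (t <= d)%N -> p \is d.-homog -> p *: z = 0.
Proof.
have hZ := annz_ideal z; split=> -[t0 h]; exists t0 => t.
  move=> p tt hp; rewrite (mpolyE p).
  apply: (subspace_sum_seq (ideal_subspace hZ)) => u us.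
  apply: (subspaceZ (ideal_subspace hZ)); apply: (h t tt) => I hI; apply.
  have [l sl el] := mnm_vars u; exists [seq 'X_i | i <- l].
  split; rewrite ?size_map ?big_map //; first by rewrite sl (dhomog_mf hp).
  by move=> g /mapP[i _ ->] J hJ; apply; exists i.
move=> tt p hp; apply: (hp _ hZ) => _ [s [ss hs ->]].
apply: irrelevant_prod_kill => // l sl; apply: (h (size l)); last exact: homog_vars.
by rewrite sl ss.
Qed.

Section Pres.
Variables (M : gmod k n) (e : M) (K : S -> Prop).
Hypothesis he : cyclic_pres e K.

Lemma cyclic_surj (x : M) : exists p : S, x = p *: e. Proof. exact: he.1. Qed.
Lemma cyclic_ker (p : S) : p *: e = 0 <-> K p. Proof. exact: he.2. Qed.

Lemma cyclic_quot (N : gsub M) :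
  @cyclic_pres (gquot N) (quot_pi N e) (fun p => N (p *: e)).
Proof.
have sc (p : S) : p *: (quot_pi N e : gquot N) = quot_pi N (p *: e) by exact: quot_piZ.
split=> [x|p].
  by have [y ->] := quot_pi_surj x; have [p ->] := cyclic_surj y; exists p; rewrite sc.
rewrite sc; split=> [h|h].
  by rewrite -[p *: e]subr0; apply/quot_pi_eq; rewrite quot_pi0; exact: h.
by apply: etrans (quot_pi0 N); apply/quot_pi_eq; rewrite subr0.
Qed.

Lemma cyclic_gamma :
  @cyclic_pres (gquot (gamma M)) (quot_pi (gamma M) e) (sat K).
Proof.
have := cyclic_quot (gamma M); congr cyclic_pres.
apply/funext => p; apply/propext; split.
  move/gamma_memP => [t h]; exists t => d q td hq; apply/cyclic_ker.
  by rewrite -scalerA; apply: h hq.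
move=> [t h]; apply/gamma_memP; exists t => d q td hq.
by rewrite scalerA; apply/cyclic_ker; apply: h hq.
Qed.

Lemma cyclic_lmul c :
  @cyclic_pres (gquot (lmul M c)) (quot_pi (lmul M c) e) (addz K (linform c)).
Proof.
have := cyclic_quot (lmul M c); congr cyclic_pres.
apply/funext => p; apply/propext; split.
  move=> [w]; have [g ->] := cyclic_surj w => h; exists g; apply/cyclic_ker.
  by rewrite scalerBl h scalerA subrr.
move=> [g /cyclic_ker h]; exists (g *: e); apply/eqP.
by rewrite -subr_eq0 scalerA -scalerBl h.
Qed.

Lemma cyclic_length (L : M -> Prop) B l : (forall p : S, L (p *: e) <-> B p) ->
  ideal K -> idl_len K B l -> length_is L l.
Proof.
move=> LB hK [[C [Cid KC CB st]] hl].
have Ce i (p : S) : (exists2 q : S, p *: e = q *: e & C i q) -> C i p.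
  move=> [q epq Cq]; rewrite -(subrK q p); apply: idealD => //; apply: KC.
  by apply/cyclic_ker; rewrite scalerBl epq subrr.
split.
  exists (fun i x => exists2 q : S, x = q *: e & C i q); split=> [i|i x|i il].
  - split; first by exists 0; rewrite ?scale0r //; exact: ideal0.
    move=> p _ _ [q -> Cq] [r -> Cr]; exists (p * q + r).
      by rewrite scalerDl scalerA.
    by apply: idealD => //; apply: ideal_mull.
  - by move=> [q -> /CB/LB].
  - have [sub [p [Cp nCp]]] := st i il; split; first by move=> x [q -> /sub]; exists q.
    exists (p *: e); split; first by exists p.
    by move=> h; apply: nCp; apply: Ce.
move=> l' [N [Nsub NL Nst]]; apply: hl; exists (fun i p => N i (p *: e)); split.
- move=> i; have [N0 NZ] := Nsub i; apply: idealI; first by rewrite scale0r.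
    by move=> p x hx; rewrite -scalerA -[_ *: _]addr0; apply: NZ.
  by move=> x y hx hy; rewrite scalerDl -[x *: e]scale1r; apply: NZ.
- by move=> i p /cyclic_ker ->; case: (Nsub i).
- by move=> i p /NL/LB.
- move=> i /Nst[sub [x [Nx nNx]]]; split; first by move=> p; exact: sub.
  by have [p ep] := cyclic_surj x; exists p; rewrite -ep.
Qed.

Lemma cyclic_zero : K 1 -> forall x : M, x = 0.
Proof.
move=> /cyclic_ker; rewrite scale1r => e0 x.
by have [p ->] := cyclic_surj x; rewrite e0 scaler0.
Qed.

Lemma mcoeff0_linform c : (linform c : S)@_0%MM = 0.
Proof.
rewrite /linform raddf_sum big1 // => i _ /=.
by rewrite mcoeffZ mcoeffX mnm1_eq0 mulr0.
Qed.

Lemma linform_irrelevant c : irrelevant (linform c : S).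
Proof.
move=> I hI h; apply: subspace_sum => [|i _]; first exact: ideal_subspace.
by apply: subspaceZ; [exact: ideal_subspace | apply: h; exists i].
Qed.

Lemma hid_one (f : S) : hid K -> K f -> f@_0%MM != 0 -> K 1.
Proof.
move=> [hK dK] /(dK 0%N) hf f0.
have e0 : pihomog mdeg 0 f = f@_0%MM *: 1.
  apply/mpolyP => m; rewrite mcoeff_pihomog mcoeffZ mcoeff1 mdeg_eq0.
  by case: eqP => [->|_]; rewrite ?mulr1 ?mulr0.
have : K ((f@_0%MM)^-1 *: pihomog mdeg 0 f) by apply: subspaceZ => //; exact: ideal_subspace.
by rewrite e0 scalerA mulVf // scale1r.
Qed.

Lemma cyclic_depth c : hid K -> ~ K 1 -> (forall f, K (linform c * f) -> K f) ->
  depth_pos M.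
Proof.
move=> hK K1 reg; exists 1%N => //; exists [:: linform c] => //; split.
- by move=> f; rewrite inE => /eqP ->; exact: linform_irrelevant.
- move=> i z; rewrite ltnS leqn0 => /eqP -> /= [w].
  rewrite big_ord0 => h; exists w; rewrite big_ord0.
  have [p ep] := cyclic_surj z; move: h; rewrite ep scalerA.
  by move=> /cyclic_ker/reg/cyclic_ker.
exists e => -[w]; rewrite big_ord1 /= => h; apply: K1.
(* Graded Nakayama: otherwise [1 - linform c * g], with constant coefficient 1, would lie in [K]. *)
have [g eg] := cyclic_surj (w ord0).
apply: (@hid_one (1 - linform c * g) hK).
  by apply/cyclic_ker; rewrite scalerBl scale1r {1}h eg scalerA subrr.
rewrite mcoeffB mcoeff1 eqxx.
have -> : (linform c * g)@_0%MM = 0.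
  apply/eqP; rewrite mcoeff_eq0; apply/negP => /msuppM_le/allpairsP[[a b] /= [ha _ e0]].
  have : a == 0%MM by have := mnmD_eq0 a b; rewrite -e0 eqxx => /esym/andP[].
  by move=> /eqP a0; move: ha; rewrite a0 mcoeff_msupp mcoeff0_linform eqxx.
by rewrite subr0 oner_neq0.
Qed.

End Pres.

(** The base value of the recursion, from the Cohen-Macaulay axiom for a module of length 0. *)
Lemma zero_bdeg (b : gmod k n -> nat) M : is_bdeg b -> (forall x : M, x = 0) -> b M = 0%N.
Proof.
move=> [_ [U _ [h _ _]]] M0; apply: h; first by left.
left; split; first by left.
split; first by exists (fun _ _ => True); split.
case=> // l [N [Nsub _ /(_ 0%N isT)[_ [x [_ nx]]]]].
by case: nx; rewrite (M0 x); case: (Nsub 0%N).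
Qed.

Lemma idl_len_full K B : ideal K -> K 1 -> ideal B -> (forall x, K x -> B x) ->
  idl_len K B 0.
Proof.
move=> hK K1 hB KB; split; first by exists (fun _ => K); split.
case=> // l [N [Nid KN _ /(_ 0%N isT)[_ [x [_ nx]]]]].
by case: nx; apply: KN; rewrite -[x]mulr1; apply: ideal_mull.
Qed.

(** Once the saturation is the whole ring there is no regular form left to choose, and the remaining
    steps contribute 0 for any [z]. *)
Lemma bval_full z ps K : ideal K -> K 1 -> bval z ps K 0.
Proof.
elim: ps K => [|q ps IH] K hK K1 /=.
  split; first by apply: idl_len_full => //; apply: idealI.
  by exists 0%N => x d p _ _; rewrite -[p * x]mulr1; apply: ideal_mull.
exists 0%N, 0%N; split=> //.
- by apply: idl_len_full => //; [exact: colinf_ideal | move=> x; exact: sub_colinf].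
- by exists 0%N => x _ d p _ _; rewrite -[p * x]mulr1; apply: ideal_mull.
- apply: IH; first exact/addz_ideal/colinf_ideal.
  exact/sub_addz/sub_colinf.
Qed.

Lemma sat_colinf K z x : z \is 1.-homog -> sat K x -> colinf K z x.
Proof.
move=> hz [t h]; exists t; apply: (h t) => //.
by have := dhomogMn t hz; rewrite mul1n.
Qed.

Lemma sat_hid K : hid K -> hid (sat K).
Proof.
move=> [hK dK]; split; first exact: sat_ideal.
move=> d f [t h]; exists t => i p ti hp.
by rewrite -(@pihomogM_eq _ _ i) //; apply: dK; apply: h hp.
Qed.

End Cyclic.

(** * The extremal cohomological degree *)

Section Bdeg.
Variables (k : fieldType) (n : nat).
Hypothesis hk : [pchar k] =i pred0.
Local Notation S := {mpoly k[n]}.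
Implicit Types (f g p : S) (K B : S -> Prop) (Y : 'M[k]_n).

Definition rowform Y (i : 'I_n) : S := linform (row i Y).

Lemma linform_mul (c : 'rV[k]_n) Y :
  linform (c *m Y) = \sum_j c 0 j *: rowform Y j.
Proof.
rewrite /rowform /linform; under [RHS]eq_bigr => j _ do rewrite scaler_sumr.
rewrite exchange_big; apply: eq_bigr => i _ /=.
by rewrite mxE scaler_suml; apply: eq_bigr => j _; rewrite scalerA mxE.
Qed.

Lemma rowform_span K Y i : ideal K -> Y \in unitmx ->
  (forall j, K (rowform Y j)) -> K 'X_i.
Proof.
move=> hK uY h; rewrite -linform_delta -(mulmxKV uY (delta_mx 0 i)) linform_mul.
apply: subspace_sum => [|j _]; first exact: ideal_subspace.
by apply: subspaceZ; first exact: ideal_subspace.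
Qed.

(** Only row [q] moves: it is that of [Y] at [t = 0] and [c] at [t = 1]. *)
Definition set_row_line Y (q : 'I_n) (c : 'rV[k]_n) (t : k) : 'M[k]_n :=
  Y + t *: \matrix_(i, j) (if i == q then c 0 j - Y q j else 0).

Lemma row_set_row_line Y q c t i : row i (set_row_line Y q c t) =
  row i Y + (if i == q then t *: (c - row q Y) else 0).
Proof.
apply/rowP => j; rewrite !mxE; case: eqP => _; rewrite !mxE ?mulr0 //.
Qed.

(** Rows outside [ps] have been used: their forms annihilate [M]. With the module now known, row [q]
    is moved to a point where the matrix is still in [A] and the row is generic for [M] modulo
    torsion. Later steps must keep that row, hence the clause on fixed rows. *)
Lemma bdeg_bval b : is_bdeg b -> forall ps (M : gmod k n) (e : M) K (A : 'M[k]_n -> Prop) Y,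
  uniq ps -> cyclic_pres e K -> hid K -> copen A -> (forall Z, A Z -> Z \in unitmx) ->
  A Y -> (forall i, i \notin ps -> K (rowform Y i)) ->
  exists Z, [/\ A Z, forall i, i \notin ps -> row i Z = row i Y &
    bval (rowform Z) ps K (b M)].
Proof.
move=> hb; have [_ [U [Uiso Uopen Ureg] [_ b2 b3]]] := hb.
elim=> [|q ps IH] M e K A Y; rewrite /= => ups he hK oA uA AY hY.
  exists Y; split=> //=.
  (* All variables lie in [K], so [M] is its own torsion and the second axiom reduces to the zero
     module. *)
  have KX i : K 'X_i by apply: (rowform_span i hK.1 (uA _ AY)) => j; exact: hY.
  have t1 x : tors K 1 x by apply: tors1 hK.1 _ => i; apply: ideal_mulr hK.1 _.
  have hT : ideal (fun _ : S => True) by apply: idealI.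
  have [s [_ hs]] := idl_len_exists hK.1 hT (fun _ _ => I) (fun x _ => t1 x).
  split; last by exists 1%N.
  have satT x : sat K x by exists 1%N.
  have hl : length_is (gamma M) (size s).
    apply: (cyclic_length (B := fun=> True) he) hK.1 hs => p; split=> // _.
    apply/gamma_memP; exists 1%N => d r d1 hr; rewrite scalerA.
    by apply/(cyclic_ker he); apply: (t1 p d).
  rewrite (b2 M _ hl) (@zero_bdeg _ _ b) ?add0n //.
  exact: cyclic_zero (cyclic_gamma he) (satT 1).
case/andP: ups => qps ups.
have [N hN] := sat_uniform hK.1.
have hs := sat_hid hK.
have [s [_ hl]] := idl_len_exists hK.1 hs.1 (fun x => @sub_sat _ _ K x hK.1) hN.
have hlg : length_is (gamma M) (size s).
  apply: (cyclic_length he _ hK.1 hl) => p; split.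
    move/gamma_memP => [t h]; exists t => d r td hr; apply/(cyclic_ker he).
    by rewrite -scalerA; apply: h hr.
  move=> [t h]; apply/gamma_memP; exists t => d r td hr.
  by rewrite scalerA; apply/(cyclic_ker he); apply: h hr.
set M1 := gquot (gamma M); have he1 := cyclic_gamma he.
have bM : b M = (b M1 + size s)%N by exact: b2.
have [s1|s1] := EM (sat K 1).
  exists Y; split=> //; exists (size s), 0%N.
  have eq : colinf K (rowform Y q) = sat K.
    apply/funext => x; apply/propext.
    have sx : sat K x by rewrite -[x]mulr1; apply: ideal_mull hs.1 _.
    by split=> // _; apply: sat_colinf; [exact: linform_homog | exact: sx].
  rewrite /flag_next eq; split=> //.
  - rewrite bM (@zero_bdeg _ _ b) ?add0n ?addn0 //; exact: cyclic_zero he1 s1.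
  - by exists N.
  - apply: bval_full; first exact: (addz_ideal _ hs.1).
    exact: sub_addz.
have [c0 hc0] := regular_linform hk hs.1 (fun x => @sat_sat _ _ K x hK.1) s1.
have dM1 : depth_pos M1 := cyclic_depth he1 hs s1 hc0.
have [W [oW [c1 Wc1] WU]] := Uopen M1.
pose Yt := set_row_line Y q c1.
have pY : polymx Yt by exact: polymx_line.
have Y0 : Yt 0 = Y by rewrite /Yt /set_row_line scale0r addr0.
have rq t : row q (Yt t) = row q Y + t *: (c1 - row q Y).
  by rewrite row_set_row_line eqxx.
have rn t i : i != q -> row i (Yt t) = row i Y.
  by move=> /negPf iq; rewrite row_set_row_line iq addr0.
have cA : cofin (fun t => A (Yt t)) by apply: (oA _ 0 pY); rewrite Y0.
have cW : cofin (fun t => W (row q (Yt t))).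
  apply: (@zariski_cofin _ _ _ _ 1 oW); last by rewrite rq scale1r subrKC.
  by move=> i j; apply: polyfun_ext (pY q j) => t; rewrite [RHS]mxE.
have [t [AYt WYt]] := cofin_exists hk (cofin_and cA cW).
set c := row q (Yt t) in WYt; set z : S := linform c.
have reg f : sat K (z * f) -> sat K f.
  have rM := Ureg _ dM1 c (WU _ WYt).
  move/(cyclic_ker he1); rewrite -scalerA => /rM h; exact/(cyclic_ker he1).
(* Since [z] is regular modulo [sat K], dividing by its powers leads no further than the
   saturation. *)
have eq : colinf K z = sat K.
  apply/funext => x; apply/propext; split; last exact/sat_colinf/linform_homog.
  move=> [i]; elim: i => [|i IHi]; first by rewrite mul1r; apply: sub_sat hK.1.
  move/(sub_sat hK.1) => h; suff : sat K (z ^+ i * x).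
    by elim: i {IHi h} => [|i IHi]; rewrite ?mul1r // exprS -mulrA => /reg.
  by apply: reg; rewrite mulrA -exprS.
have he2 := cyclic_lmul he1 c.
have hK2 : hid (addz (sat K) z) by apply: addz_hid hs; exact: linform_homog.
have [|Z [AZ rZ bZ]] := IH _ _ _ A (Yt t) ups he2 hK2 oA uA AYt.
  move=> i ips; have [->|iq] := eqVneq i q.
    by exists 1; rewrite mulr1 subrr; exact: ideal0 hs.1.
  apply/sub_addz/(sub_sat hK.1); rewrite /rowform rn //; apply: hY.
  by rewrite inE negb_or iq.
exists Z; split=> //.
  move=> i; rewrite inE negb_or => /andP[iq ips].
  by rewrite rZ // rn.
have zq : rowform Z q = z by rewrite /rowform rZ.
exists (size s), (b (gquot (lmul M1 c))); rewrite /flag_next zq eq; split=> //.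
- by rewrite bM addnC (b3 M1 c dM1 (WU _ WYt)).
- by exists N.
Qed.

Lemma hideal_hid (I : hideal k n) : hid (I : S -> Prop).
Proof.
split; first exact: gs_submod I.
move=> d f If; have [le|lt] := leqP (msize f) d.
  have -> : pihomog mdeg d f = 0.
    apply/mpolyP => m; rewrite mcoeff0 mcoeff_pihomog; case: eqP => // e.
    by apply: memN_msupp_eq0; apply: msize_mdeg_ge; rewrite e.
  exact: (gs_submod I).1.
pose F (i : int) : S := if i is Posz j then pihomog mdeg j f else 0.
apply: (@gs_homog _ _ _ I [seq Posz i | i <- iota 0 (msize f)] F _ _ _ (Posz d)).
- by rewrite map_inj_uniq ?iota_uniq // => a b [].
- by move=> [i|i] //=; apply: pihomogP.
- rewrite big_map -[X in iota 0 X]subn0 big_mkord /=.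
  by rewrite -pihomog_decomp.
- by rewrite map_f // mem_iota.
Qed.

Lemma pairwise_rev_enum : pairwise (fun i j : 'I_n => j < i)%N (rev (enum 'I_n)).
Proof.
rewrite -sorted_pairwise; last by move=> j i l /= ij jl; apply: ltn_trans jl ij.
rewrite rev_sorted; have : sorted ltn (map val (enum 'I_n)).
  by rewrite val_enum_ord iota_ltn_sorted.
by rewrite sorted_map.
Qed.

(** [generic_exists] supplies the set in which [bdeg_bval] moves its matrix; the inverse transpose
    of the result sends the chosen forms to the variables, where [bval_beta] reads off [E]. *)
Lemma bdeg_beta b (I : hideal k n) E s0 : is_bdeg b -> dominated I E ->
  s0 \in unitmx -> (forall m, lmset (lin_change_ideal s0 I) m <-> E m) ->
  beta (rev (enum 'I_n)) E (b (gquot I)).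
Proof.
move=> hb dom us0 hE; have hI := hideal_hid I.
have [A [oA [Y AY] hA]] := generic_exists hI dom us0 hE.
have he : @cyclic_pres _ _ (gquot I) (quot_pi I (1 : S)) I.
  have := @cyclic_quot _ _ (gpoly k n) (1 : S) (fun p => p = 0) _ I.
  have e1 (p : S) : p *: (1 : gpoly k n) = p by exact: mulr1.
  have -> : (fun p : S => I (p *: (1 : gpoly k n))) = I.
    by apply/funext => p; rewrite e1.
  apply; split=> [x|p]; first by exists x; rewrite e1.
  by rewrite e1.
have [||Z [AZ _ hZ]] := bdeg_bval hb _ he hI oA (fun Z h => (hA Z h).1) AY (ps := rev (enum 'I_n)).
- by rewrite rev_uniq enum_uniq.
- by move=> i; rewrite mem_rev mem_enum.
have [uZ lZ] := hA Z AZ.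
have uI : (invmx Z)^T \in unitmx by rewrite unitmx_tr unitmx_inv.
have := push_bval (mulmxV uI) (mulVmx uI) hZ.
rewrite (push_image (mulmxV uI) (mulVmx uI)).
have -> : (fun i => lin_change (invmx Z)^T (rowform Z i)) = (fun i => 'X_i).
  apply/funext => i; rewrite lin_change_linform trmxK -row_mul mulmxV //.
  by rewrite row1 linform_delta.
move/(bval_beta (img_hid uI hI) pairwise_rev_enum).
have -> : lmset (lin_change_ideal (invmx Z)^T I) = E.
  by apply/funext => m; apply/propext.
by apply=> i; rewrite mem_rev mem_enum.
Qed.

End Bdeg.

Theorem theorem10 (k : fieldType) (hk : [pchar k] =i pred0) (n : nat)
    (bdeg : gmod k n -> nat) (hbdeg : is_bdeg bdeg)
    (I ginI : hideal k n) (hgin : is_gin I ginI) :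
  bdeg (gquot I) = bdeg (gquot ginI).
Proof.
have [W [oW [s0 us0 Ws0] hW]] := hgin.
have hI := hideal_hid I; have hJ := hideal_hid ginI.
pose E := lmset ginI.
have hin s : s \in unitmx -> W (mxvec s) ->
    forall m, lmset (lin_change_ideal s I) m <-> E m.
  move=> us Ws; have his := img_hid us hI; move=> m; split.
    move=> hm; exists 'X_[m]; last exact: leadX.
    apply/(hW s us Ws)/(initial_idealP _ his.1) => u.
    by have [<-//|ne] := eqVneq m u; rewrite mcoeffX (negPf ne) eqxx.
  by move=> [f /(hW s us Ws)/(initial_idealP _ his.1) h [fm _]]; apply: h.
have dI : dominated I E := dominated_open hk hI oW us0 Ws0 hin.
have dJ : dominated ginI E.
  apply: (dominated_initial hk us0 hI _ dI) => f.
  by move/(hW s0 us0 Ws0)/(initial_idealP _ (img_hid us0 hI).1).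
(* For the generic initial ideal the identity matrix already attains the bound [E]. *)
have img1 : lin_change_ideal 1%:M ginI = ginI.
  apply/funext => f; apply/propext; split=> [[g Jg ->]|Jf].
    by rewrite lin_change_id.
  by exists f; rewrite ?lin_change_id.
apply: (beta_fun (fun m => iff_refl (E m))).
  exact: (bdeg_beta hk hbdeg dI us0 (hin s0 us0 Ws0)).
apply: (bdeg_beta hk hbdeg dJ (unitmx1 _ _)) => m.
by rewrite img1.
Qed.
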